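(* Let $k$ be a field, and let $A$ and $B$ be finite dimensional $k$-algebras (of infinite global dimension). Let $({}_AM_B,{}_BN_A)$ define a singular equivalence of Morita type with level $n$ between $A$ and $B$ such that $\mathrm{Hom}_A(M,A)$ has finite projective dimension as a $B$-module and $\mathrm{Hom}_B(N,B)$ has finite projective dimension as an $A$-module. Then the functors $$M\otimes_B-:\underline{\mathcal{G}_B}\to\underline{\mathcal{G}_A}\quad\text{and}\quad N\otimes_A-:\underline{\mathcal{G}_A}\to\underline{\mathcal{G}_B}$$ are equivalences, which are quasi-inverse to each other.
   Context: Conventions: $\otimes=\otimes_k$; $A^e=A\otimes A^{\mathrm{op}}$; $A\text{-}\mathrm{mod}$ is the category of finitely generated left $A$-modules and $A\text{-}\underline{\mathrm{mod}}$ its stable category modulo projectives; $\Omega^n$ denotes the $n$-th syzygy. $\mathrm{Hom}_A(M,A)$ denotes homomorphisms of left $A$-modules, a $B$-$A$-bimodule (viewed here as a left $B$-module); $\mathrm{Hom}_B(N,B)$ denotes homomorphisms of left $B$-modules, an $A$-$B$-bimodule (viewed here as a left $A$-module). Singular equivalence of Morita type with level $n$ ($n\ge 0$): a pair $(M,N)$ of a finitely generated $A$-$B$-bimodule $M$ and a finitely generated $B$-$A$-bimodule $N$ (with $k$ acting centrally) such that (1) $M$ is projective as a left $A$-module and as a right $B$-module; (2) $N$ is projective as a left $B$-module and as a right $A$-module; (3) $M\otimes_BN\cong\Omega^n_{A^e}(A)$ in $A^e\text{-}\underline{\mathrm{mod}}$ and $N\otimes_AM\cong\Omega^n_{B^e}(B)$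 in $B^e\text{-}\underline{\mathrm{mod}}$. Gorenstein dimension zero: a finitely generated $A$-module $X$ has Gorenstein dimension zero if the natural map $X\to\mathrm{Hom}_A(\mathrm{Hom}_A(X,A),A)$ is an isomorphism and $\mathrm{Ext}^i_A(X,A)=\mathrm{Ext}^i_A(\mathrm{Hom}_A(X,A),A)=0$ for all $i>0$. $\mathcal{G}_A\subset A\text{-}\mathrm{mod}$ is the full subcategory of such modules, and $\underline{\mathcal{G}_A}$ is the full subcategory of $A\text{-}\underline{\mathrm{mod}}$ given by the image of $\mathcal{G}_A$; likewise for $B$.
   Formalization: ''Quasi-inverse to each other'' is false for n>0 (A=B=N=k[x]/(x^3), M=Ω_{A^e}(A), n=1); it is replaced by: both composites are naturally isomorphic to Ω^n, an autoequivalence of the stable category of Gorenstein-dimension-zero modules (the identity when n=0). *)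

(* Defs.v *)
From HB Require Import structures.
From mathcomp Require Import all_boot all_algebra falgebra.

Set Implicit Arguments.
Unset Strict Implicit.
Unset Printing Implicit Defensive.

Import GRing.Theory VectorInternalTheory.
Local Open Scope ring_scope.

(* All algebras are finite dimensional over the field k, so a finitely
   generated module is a finite dimensional k-vector space with an action.
   [bimod A B] is the type of A-B-bimodules on which k acts centrally, that is
   of (A (x) B^op)-modules: [bimod A A] plays the role of A^e-mod,
   [lmod A] = [bimod A k] that of A-mod and [bimod k A] that of A^op-mod.
   Only one theory of projectives, syzygies, Ext and stable categories is
   needed for all of them. *)
Record bimod (k : fieldType) (A B : falgType k) := Bimod {
  bcar :> vectType k;
  lact : A -> 'End(bcar);
  ract : B -> 'End(bcar);
  lact_linear : linear lact;
  ract_linear : linear ract;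
  lact1 : lact 1 = \1%VF;
  ract1 : ract 1 = \1%VF;
  lactM : forall a a', lact (a * a') = (lact a \o lact a')%VF;
  ractM : forall b b', ract (b * b') = (ract b' \o ract b)%VF;
  lractC : forall a b, (lact a \o ract b = ract b \o lact a)%VF
}.
Arguments Bimod {k A B}.
Arguments lact {k A B} _ _.
Arguments ract {k A B} _ _.

Notation lmod A := (bimod A _^o) (only parsing).

Record bihom (k : fieldType) (A B : falgType k) (X Y : bimod A B) := Bihom {
  hfun :> 'Hom(X, Y);
  hom_lact : forall a, (hfun \o lact X a = lact Y a \o hfun)%VF;
  hom_ract : forall b, (hfun \o ract X b = ract Y b \o hfun)%VF
}.
Arguments Bihom {k A B X Y}.

Section Pointwise.
Variables (k : fieldType) (A B : falgType k).
Implicit Types (X Y Z : bimod A B).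

Lemma lact1E X x : lact X 1 x = x.
Proof. by rewrite lact1 id_lfunE. Qed.
Lemma ract1E X x : ract X 1 x = x.
Proof. by rewrite ract1 id_lfunE. Qed.
Lemma lactME X a a' x : lact X (a * a') x = lact X a (lact X a' x).
Proof. by rewrite lactM comp_lfunE. Qed.
Lemma ractME X b b' x : ract X (b * b') x = ract X b' (ract X b x).
Proof. by rewrite ractM comp_lfunE. Qed.
Lemma lractCE X a b x : lact X a (ract X b x) = ract X b (lact X a x).
Proof. by rewrite -comp_lfunE lractC comp_lfunE. Qed.
Lemma lactPE X c a a' x :
  lact X (c *: a + a') x = c *: lact X a x + lact X a' x.
Proof. by rewrite lact_linear add_lfunE scale_lfunE. Qed.
Lemma ractPE X c b b' x :
  ract X (c *: b + b') x = c *: ract X b x + ract X b' x.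
Proof. by rewrite ract_linear add_lfunE scale_lfunE. Qed.
Lemma hom_lactE X Y (f : bihom X Y) a x : f (lact X a x) = lact Y a (f x).
Proof. by rewrite -!comp_lfunE hom_lact. Qed.
Lemma hom_ractE X Y (f : bihom X Y) b x : f (ract X b x) = ract Y b (f x).
Proof. by rewrite -!comp_lfunE hom_ract. Qed.

Definition mkhom X Y (f : 'Hom(X, Y))
    (fl : forall a x, f (lact X a x) = lact Y a (f x))
    (fr : forall b x, f (ract X b x) = ract Y b (f x)) : bihom X Y.
Proof.
exists f => c; apply/lfunP => x; rewrite !comp_lfunE; [exact: fl|exact: fr].
Defined.

Definition idhom X : bihom X X.
Proof. by apply: (@mkhom X X \1%VF) => a x; rewrite !id_lfunE. Defined.

Definition comphom X Y Z (g : bihom Y Z) (f : bihom X Y) : bihom X Z.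
Proof.
apply: (@mkhom X Z (g \o f)%VF) => a x; rewrite !comp_lfunE.
  by rewrite !hom_lactE.
by rewrite !hom_ractE.
Defined.

Definition zerohom X Y : bihom X Y.
Proof.
by apply: (@mkhom X Y 0) => a x; rewrite !zero_lfunE linear0.
Defined.

Definition addhom X Y (f g : bihom X Y) : bihom X Y.
Proof.
apply: (@mkhom X Y (hfun f + hfun g)) => a x; rewrite !add_lfunE linearD.
  by rewrite !hom_lactE.
by rewrite !hom_ractE.
Defined.

Definition opphom X Y (f : bihom X Y) : bihom X Y.
Proof.
apply: (@mkhom X Y (- hfun f)) => a x; rewrite !opp_lfunE linearN.
  by rewrite !hom_lactE.
by rewrite !hom_ractE.
Defined.

End Pointwise.

Section SubQuo.
Variables (k : fieldType) (A B : falgType k) (X : bimod A B).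

Definition stable_sub (U : {vspace X}) : Prop :=
  (forall a x, x \in U -> lact X a x \in U) /\
  (forall b x, x \in U -> ract X b x \in U).

Section Sub.
Variables (U : {vspace X}) (sU : stable_sub U).

Definition sub_end (f : 'End(X)) : 'End(subvs_of U) :=
  linfun (vsproj U \o f \o vsval).

Lemma sub_endE (f : 'End(X)) (fU : forall x, x \in U -> f x \in U) u :
  vsval (sub_end f u) = f (vsval u).
Proof. by rewrite lfunE /= vsprojK // fU // subvsP. Qed.

Let slE a u : vsval (sub_end (lact X a) u) = lact X a (vsval u).
Proof. exact: sub_endE (sU.1 a) u. Qed.
Let srE b u : vsval (sub_end (ract X b) u) = ract X b (vsval u).
Proof. exact: sub_endE (sU.2 b) u. Qed.

Definition submod : bimod A B.
Proof.
refine (Bimod (subvs_of U) (fun a => sub_end (lact X a))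
          (fun b => sub_end (ract X b)) _ _ _ _ _ _ _).
- move=> c a a'; apply/lfunP => u; apply: subvs_inj.
  by rewrite add_lfunE scale_lfunE linearP /= !slE lactPE.
- move=> c a a'; apply/lfunP => u; apply: subvs_inj.
  by rewrite add_lfunE scale_lfunE linearP /= !srE ractPE.
- by apply/lfunP => u; apply: subvs_inj; rewrite slE lact1E id_lfunE.
- by apply/lfunP => u; apply: subvs_inj; rewrite srE ract1E id_lfunE.
- move=> a a'; apply/lfunP => u; apply: subvs_inj.
  by rewrite comp_lfunE !slE lactME.
- move=> a a'; apply/lfunP => u; apply: subvs_inj.
  by rewrite comp_lfunE !srE ractME.
- move=> a b; apply/lfunP => u; apply: subvs_inj.
  by rewrite !comp_lfunE slE !srE slE lractCE.
Defined.

Lemma submod_lactE a (u : submod) :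
  vsval (lact submod a u : subvs_of U) = lact X a (vsval (u : subvs_of U)).
Proof. exact: slE. Qed.
Lemma submod_ractE b (u : submod) :
  vsval (ract submod b u : subvs_of U) = ract X b (vsval (u : subvs_of U)).
Proof. exact: srE. Qed.

Definition subincl : bihom submod X.
Proof.
apply: (@mkhom _ _ _ submod X (linfun vsval)) => c u; rewrite !(lfunE vsval).
  exact: submod_lactE.
exact: submod_ractE.
Defined.

End Sub.

(* X / R is realised on the image of the projection \1 - projv R, whose kernel
   is R. *)
Section Quo.
Variables (R : {vspace X}) (sR : stable_sub R).

Definition quo_space : {vspace X} := limg (\1 - projv R)%VF.

Definition quo_proj : 'Hom(X, subvs_of quo_space) :=
  linfun (vsproj quo_space \o (\1 - projv R)%VF).

Lemma vsval_quo_proj x : vsval (quo_proj x) = x - projv R x.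
Proof.
rewrite lfunE /= vsprojK ?memv_img ?memvf //.
by rewrite add_lfunE opp_lfunE id_lfunE.
Qed.

Lemma quo_proj_eq0 x : (quo_proj x == 0) = (x \in R).
Proof.
apply/eqP/idP => [/(congr1 vsval)|xR].
  rewrite vsval_quo_proj linear0 => /eqP; rewrite subr_eq0 => /eqP ->.
  exact: memv_proj.
by apply: subvs_inj; rewrite vsval_quo_proj projv_id // subrr linear0.
Qed.

Lemma quo_projK u : quo_proj (vsval u) = u.
Proof.
apply: subvs_inj; rewrite vsval_quo_proj.
have /memv_imgP [x _ ->] := subvsP u.
by rewrite !add_lfunE !opp_lfunE !id_lfunE linearB /= projv_proj subrr subr0.
Qed.

Lemma vsval_quoP x : x - vsval (quo_proj x) \in R.
Proof. by rewrite -quo_proj_eq0 linearB /= quo_projK subrr. Qed.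

Definition quo_end (f : 'End(X)) : 'End(subvs_of quo_space) :=
  linfun (quo_proj \o f \o vsval).

Lemma quo_endE (f : 'End(X)) (fR : forall x, x \in R -> f x \in R) x :
  quo_end f (quo_proj x) = quo_proj (f x).
Proof.
rewrite lfunE /=; apply/eqP; rewrite -subr_eq0 -linearB -linearB /=.
by rewrite quo_proj_eq0 fR // -opprB memvN vsval_quoP.
Qed.

Let qlE a x : quo_end (lact X a) (quo_proj x) = quo_proj (lact X a x).
Proof. exact: quo_endE (sR.1 a) x. Qed.
Let qrE b x : quo_end (ract X b) (quo_proj x) = quo_proj (ract X b x).
Proof. exact: quo_endE (sR.2 b) x. Qed.

Definition quomod : bimod A B.
Proof.
refine (Bimod (subvs_of quo_space) (fun a => quo_end (lact X a))
          (fun b => quo_end (ract X b)) _ _ _ _ _ _ _).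
- move=> c a a'; apply/lfunP => u; rewrite -(quo_projK u).
  by rewrite add_lfunE scale_lfunE !qlE lactPE linearP.
- move=> c a a'; apply/lfunP => u; rewrite -(quo_projK u).
  by rewrite add_lfunE scale_lfunE !qrE ractPE linearP.
- by apply/lfunP => u; rewrite -(quo_projK u) qlE lact1E id_lfunE.
- by apply/lfunP => u; rewrite -(quo_projK u) qrE ract1E id_lfunE.
- move=> a a'; apply/lfunP => u; rewrite -(quo_projK u).
  by rewrite comp_lfunE !qlE lactME.
- move=> a a'; apply/lfunP => u; rewrite -(quo_projK u).
  by rewrite comp_lfunE !qrE ractME.
- move=> a b; apply/lfunP => u; rewrite -(quo_projK u).
  by rewrite !comp_lfunE qlE !qrE qlE lractCE.
Defined.

Definition quohom : bihom X quomod.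
Proof.
apply: (@mkhom _ _ _ X quomod quo_proj) => c x; first exact/esym/qlE.
exact/esym/qrE.
Defined.

End Quo.
End SubQuo.

Section TensorSpace.
Variable k : fieldType.
Implicit Types V W Z : vectType k.

(* V (x)_k W is the space of matrices indexed by bases of V and W. *)
Definition tspace V W : vectType k := 'M[k]_(dim V, dim W).

Definition tpure V W (v : V) (w : W) : tspace V W := (v2r v)^T *m v2r w.

Definition bilin V W Z (phi : V -> W -> Z) : Prop :=
  (forall w, linear (phi^~ w)) /\ (forall v, linear (phi v)).

Definition tlift_fun V W Z (phi : V -> W -> Z) (t : tspace V W) : Z :=
  \sum_i \sum_j t i j *: phi (r2v (delta_mx 0 i)) (r2v (delta_mx 0 j)).

Lemma tlift_linear V W Z (phi : V -> W -> Z) : linear (tlift_fun phi).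
Proof.
move=> c s t; rewrite /tlift_fun scaler_sumr -big_split; apply: eq_bigr => i _.
rewrite /= scaler_sumr -big_split; apply: eq_bigr => j _.
by rewrite !mxE scalerDl scalerA.
Qed.

HB.instance Definition _ V W Z (phi : V -> W -> Z) :=
  GRing.isLinear.Build k (tspace V W) Z _ (tlift_fun phi) (tlift_linear phi).

(* Locked, like [mklfun]: otherwise failed matches of ['Hom] terms unfold the
   big sums. *)
Fact tlift_key : unit. Proof. by []. Qed.
Definition tlift_def V W Z (phi : V -> W -> Z) : 'Hom(tspace V W, Z) :=
  linfun (tlift_fun phi).
Definition tlift := locked_with tlift_key tlift_def.
Canonical tlift_unlockable := [unlockable fun tlift].
Arguments tlift {V W Z} phi.

Fact mklfun_key : unit. Proof. by []. Qed.
Definition mklfun_def (V W : vectType k) (f : V -> W) (fL : linear f) :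
    'Hom(V, W) :=
  let l := GRing.isLinear.Build k V W _ f fL in
  let F : {linear V -> W} := HB.pack f l in linfun F.
Definition mklfun := locked_with mklfun_key mklfun_def.
Canonical mklfun_unlockable := [unlockable fun mklfun].
Arguments mklfun {V W f} fL.

Lemma mklfunE (V W : vectType k) (f : V -> W) (fL : linear f) x :
  mklfun fL x = f x.
Proof. by rewrite [@mklfun]unlock /mklfun_def lfunE. Qed.

Lemma v2r_sum V (v : V) : v = \sum_i v2r v 0 i *: r2v (delta_mx 0 i).
Proof.
apply: v2r_inj; rewrite linear_sum /= {1}[v2r v]row_sum_delta.
by apply: eq_bigr => i _; rewrite linearZ /= r2vK.
Qed.

Lemma tliftE V W Z (phi : V -> W -> Z) (bphi : bilin phi) v w :
  tlift phi (tpure v w) = phi v w.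
Proof.
have [phil phir] := bphi; rewrite [@tlift]unlock /tlift_def lfunE /= /tlift_fun.
pose pl w := GRing.isLinear.Build k V Z _ (phi^~ w) (phil w).
pose Pl w : {linear V -> Z} := HB.pack (phi^~ w) (pl w).
pose pr v := GRing.isLinear.Build k W Z _ (phi v) (phir v).
pose Pr v : {linear W -> Z} := HB.pack (phi v) (pr v).
rewrite [in RHS](v2r_sum v) -[RHS]/(Pl w _) linear_sum; apply: eq_bigr => i _.
rewrite linearZ /= [in RHS](v2r_sum w) -[X in _ = _ *: X]/(Pr _ _) linear_sum.
rewrite scaler_sumr; apply: eq_bigr => j _.
by rewrite linearZ /= scalerA /tpure !mxE big_ord1 !mxE.
Qed.

Lemma tpure_bilin V W : bilin (@tpure V W).
Proof.
split=> [w|v] c x y; rewrite /tpure linearP /=.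
  by rewrite linearP /= mulmxDl scalemxAl.
by rewrite mulmxDr scalemxAr.
Qed.

Lemma tspace_ext V W Z (f g : 'Hom(tspace V W, Z)) :
  (forall v w, f (tpure v w) = g (tpure v w)) -> f = g.
Proof.
move=> fg; apply/lfunP => t; rewrite [t]matrix_sum_delta !linear_sum.
apply: eq_bigr => i _; rewrite !linear_sum; apply: eq_bigr => j _.
have -> : delta_mx i j = tpure (r2v (delta_mx 0 i)) (r2v (delta_mx 0 j)) :> tspace V W.
  by rewrite /tpure !r2vK trmx_delta mul_delta_mx.
by rewrite !linearZ /= fg.
Qed.

Definition tmap V V' W W' (f : 'Hom(V, V')) (g : 'Hom(W, W')) :
    'Hom(tspace V W, tspace V' W') :=
  tlift (fun v w => tpure (f v) (g w)).

Lemma tmapE V V' W W' (f : 'Hom(V, V')) (g : 'Hom(W, W')) v w :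
  tmap f g (tpure v w) = tpure (f v) (g w).
Proof.
have [pl pr] := tpure_bilin V' W'.
apply: (@tliftE _ _ _ (fun v w => tpure (f v) (g w))).
by split=> [y|x] c x1 x2; rewrite linearP ?pl ?pr.
Qed.

Lemma tpurePl V W c (v v' : V) (w : W) :
  tpure (c *: v + v') w = c *: tpure v w + tpure v' w.
Proof. exact: (tpure_bilin V W).1. Qed.
Lemma tpurePr V W c (v : V) (w w' : W) :
  tpure v (c *: w + w') = c *: tpure v w + tpure v w'.
Proof. exact: (tpure_bilin V W).2. Qed.

End TensorSpace.

(* M (x)_k X, with the outer actions of an A-B-bimodule M and a C-D-bimodule X. *)
Definition ktens (k : fieldType) (A B C D : falgType k)
  (M : bimod A B) (X : bimod C D) : bimod A D.
Proof.
refine (Bimod (tspace M X) (fun a => tmap (lact M a) \1%VF)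
          (fun d => tmap \1%VF (ract X d)) _ _ _ _ _ _ _).
- move=> c a a'; apply: tspace_ext => m x.
  by rewrite add_lfunE scale_lfunE !tmapE !id_lfunE lactPE tpurePl.
- move=> c a a'; apply: tspace_ext => m x.
  by rewrite add_lfunE scale_lfunE !tmapE !id_lfunE ractPE tpurePr.
- by apply: tspace_ext => m x; rewrite !tmapE !id_lfunE lact1E.
- by apply: tspace_ext => m x; rewrite !tmapE !id_lfunE ract1E.
- by move=> a a'; apply: tspace_ext => m x;
     rewrite !comp_lfunE !tmapE !id_lfunE lactME.
- by move=> a a'; apply: tspace_ext => m x;
     rewrite !comp_lfunE !tmapE !id_lfunE ractME.
- by move=> a d; apply: tspace_ext => m x; rewrite !comp_lfunE !tmapE !id_lfunE.
Defined.

Section Tensor.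
Variables (k : fieldType) (A B C : falgType k).
Implicit Types (M : bimod A B) (X Y : bimod B C) (Z : vectType k).

Definition tens_rel1 M X (b : B) : 'End(tspace M X) :=
  tmap (ract M b) \1%VF - tmap \1%VF (lact X b).

(* The span of the elements (m b) (x) x - m (x) (b x). *)
Definition tens_rel M X : {vspace ktens M X} :=
  (\sum_(i < \dim {:B}) limg (tens_rel1 M X (vbasis {:B})`_i))%VS.

Lemma tens_rel1E M X b m x :
  tens_rel1 M X b (tpure m x) = tpure (ract M b m) x - tpure m (lact X b x).
Proof. by rewrite add_lfunE opp_lfunE !tmapE !id_lfunE. Qed.

Lemma tens_rel1P M X : linear (tens_rel1 M X).
Proof.
move=> c b b'; apply: tspace_ext => m x.
rewrite [RHS]add_lfunE scale_lfunE !tens_rel1E.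
by rewrite ractPE lactPE tpurePl tpurePr scalerBr opprD addrACA.
Qed.

HB.instance Definition _ M X := GRing.isLinear.Build k B 'End(tspace M X) _
  (tens_rel1 M X) (@tens_rel1P M X).

Lemma tens_rel_mem M X b t : tens_rel1 M X b t \in tens_rel M X.
Proof.
rewrite (coord_vbasis (memvf b)) linear_sum sum_lfunE.
apply: memv_suml => i _; rewrite linearZ /= scale_lfunE memvZ //.
apply: subvP (memv_img _ (memvf t)).
exact: (@sumv_sup _ _ _ i predT _
  (fun j : 'I_(\dim {:B}) => limg (tens_rel1 M X (vbasis {:B})`_j))).
Qed.

Lemma tens_rel_ind M X Z (g : 'Hom(tspace M X, Z)) (U : {vspace Z}) :
  (forall b t, g (tens_rel1 M X b t) \in U) ->
  forall t, t \in tens_rel M X -> g t \in U.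
Proof.
move=> gU t => /memv_sumP [ts tsP ->].
rewrite linear_sum; apply: memv_suml => i _.
have /memv_imgP [s _ ->] := tsP i isT; exact: gU.
Qed.

Lemma tens_rel_stable M X : stable_sub (tens_rel M X).
Proof.
split=> c; apply: tens_rel_ind => b t.
  rewrite -comp_lfunE.
  have -> : (lact (ktens M X) c \o tens_rel1 M X b
             = tens_rel1 M X b \o lact (ktens M X) c)%VF.
    apply: tspace_ext => m x; rewrite !comp_lfunE tens_rel1E /= linearB /=.
    by rewrite !tmapE tens_rel1E !id_lfunE lractCE.
  by rewrite comp_lfunE tens_rel_mem.
rewrite -comp_lfunE.
have -> : (ract (ktens M X) c \o tens_rel1 M X b
           = tens_rel1 M X b \o ract (ktens M X) c)%VF.
  apply: tspace_ext => m x; rewrite !comp_lfunE tens_rel1E /= linearB /=.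
  by rewrite !tmapE tens_rel1E !id_lfunE lractCE.
by rewrite comp_lfunE tens_rel_mem.
Qed.

Definition tens M X : bimod A C := quomod (tens_rel_stable M X).

Definition tens_pure M X (m : M) (x : X) : tens M X :=
  quo_proj (tens_rel M X) (tpure m x).

Lemma tens_pure_bilin M X : bilin (@tens_pure M X).
Proof.
by split=> [x|m] c u v; rewrite /tens_pure ?tpurePl ?tpurePr linearP.
Qed.

Lemma tens_balanced M X b m x :
  tens_pure (ract M b m) x = tens_pure m (lact X b x).
Proof.
suff: quo_proj (tens_rel M X) (tens_rel1 M X b (tpure m x)) == 0.
  by rewrite tens_rel1E linearB subr_eq0 => /eqP.
by rewrite quo_proj_eq0 tens_rel_mem.
Qed.

Lemma lact_pure M X a m x :
  lact (tens M X) a (tens_pure m x) = tens_pure (lact M a m) x.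
Proof.
rewrite -[LHS](hom_lactE (quohom (tens_rel_stable M X)) a) /= tmapE.
by rewrite id_lfunE.
Qed.

Lemma ract_pure M X c m x :
  ract (tens M X) c (tens_pure m x) = tens_pure m (ract X c x).
Proof.
rewrite -[LHS](hom_ractE (quohom (tens_rel_stable M X)) c) /= tmapE.
by rewrite id_lfunE.
Qed.

Lemma tens_ext M X Z (f g : 'Hom(tens M X, Z)) :
  (forall m x, f (tens_pure m x) = g (tens_pure m x)) -> f = g.
Proof.
move=> fg; pose q : 'Hom(tspace M X, tens M X) := quo_proj (tens_rel M X).
have e : (f \o q = g \o q)%VF.
  by apply: tspace_ext => m x; rewrite !comp_lfunE; apply: fg.
apply/lfunP => u; rewrite -(quo_projK u).
by have /lfunP/(_ (vsval u)) := e; rewrite !comp_lfunE.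
Qed.

Definition tens_lift M X Z (phi : M -> X -> Z) : 'Hom(tens M X, Z) :=
  linfun (tlift phi \o vsval).

Lemma tens_liftE M X Z (phi : M -> X -> Z) : bilin phi ->
  (forall b m x, phi (ract M b m) x = phi m (lact X b x)) ->
  forall m x, tens_lift phi (tens_pure m x) = phi m x.
Proof.
move=> bphi bal m x; rewrite lfunE /= -[RHS](tliftE bphi).
apply/esym/eqP; rewrite -subr_eq0 -linearB -memv0.
apply: (@tens_rel_ind M X Z) (vsval_quoP _ _) => b t.
rewrite -comp_lfunE; have -> : (tlift phi \o tens_rel1 M X b = 0)%VF.
  apply: tspace_ext => m' x'.
  by rewrite comp_lfunE tens_rel1E linearB /= !tliftE // bal subrr zero_lfunE.
by rewrite zero_lfunE mem0v.
Qed.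

Lemma tensmap_bilin M X Y (f : bihom X Y) :
  bilin (fun (m : M) (x : X) => tens_pure m (f x)).
Proof.
have [pl pr] := tens_pure_bilin M Y.
by split=> [x|m] c u v; rewrite ?linearP ?pl ?pr.
Qed.

Definition tensmap_lfun M X Y (f : bihom X Y) : 'Hom(tens M X, tens M Y) :=
  tens_lift (fun (m : M) (x : X) => tens_pure m (f x)).

Lemma tensmap_lfunE M X Y (f : bihom X Y) m x :
  tensmap_lfun M f (tens_pure m x) = tens_pure m (f x).
Proof.
apply: (@tens_liftE M X (tens M Y) (fun m x => tens_pure m (f x))).
  exact: tensmap_bilin.
by move=> b m' x'; rewrite hom_lactE tens_balanced.
Qed.

Definition tensmap M X Y (f : bihom X Y) : bihom (tens M X) (tens M Y).
Proof.
exists (tensmap_lfun M f) => c; apply: tens_ext => m x; rewrite !comp_lfunE.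
  by rewrite lact_pure !tensmap_lfunE lact_pure.
by rewrite ract_pure !tensmap_lfunE ract_pure hom_ractE.
Defined.

Lemma tensmapE M X Y (f : bihom X Y) m x :
  tensmap M f (tens_pure m x) = tens_pure m (f x).
Proof. exact: tensmap_lfunE. Qed.

End Tensor.

Definition reg (k : fieldType) (A : falgType k) : bimod A A.
Proof.
refine (Bimod (A : vectType k) (fun a => amull a) (fun a => amulr a)
          _ _ _ _ _ _ _).
- exact: linearP.
- exact: linearP.
- by apply/lfunP => x; rewrite lfunE id_lfunE /= mul1r.
- by apply/lfunP => x; rewrite lfunE id_lfunE /= mulr1.
- by move=> a a'; apply/lfunP => x; rewrite comp_lfunE !lfunE /= mulrA.
- by move=> a a'; apply/lfunP => x; rewrite comp_lfunE !lfunE /= mulrA.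
- by move=> a a'; apply/lfunP => x; rewrite !comp_lfunE !lfunE /= mulrA.
Defined.

Section Restriction.
Variables (k : fieldType) (A B : falgType k) (M : bimod A B).

Let scalP (V : vectType k) : linear (fun c : k^o => c *: (\1%VF : 'End(V))).
Proof. by move=> c a a'; rewrite scalerDl -scalerA. Qed.

Definition lres : lmod A.
Proof.
refine (@Bimod k A k^o (bcar M) (lact M) (fun c : k^o => c *: \1%VF)
          _ _ _ _ _ _ _).
- exact: lact_linear.
- exact: scalP.
- exact: lact1.
- exact: scale1r.
- exact: lactM.
- by move=> b b'; rewrite -comp_lfunZl comp_lfun1l scalerA mulrC.
- by move=> a b; rewrite -comp_lfunZl -comp_lfunZr comp_lfun1l comp_lfun1r.
Defined.

Definition rres : bimod k^o B.
Proof.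
refine (@Bimod k k^o B (bcar M) (fun c : k^o => c *: \1%VF) (ract M)
          _ _ _ _ _ _ _).
- exact: scalP.
- exact: ract_linear.
- exact: scale1r.
- exact: ract1.
- by move=> b b'; rewrite -comp_lfunZl comp_lfun1l scalerA.
- exact: ractM.
- by move=> a b; rewrite -comp_lfunZl -comp_lfunZr comp_lfun1l comp_lfun1r.
Defined.

End Restriction.

Section HomSpace.
Variable k : fieldType.
Implicit Types V W : vectType k.

Definition precomp_fun V V' W (g : 'Hom(V', V)) (f : 'Hom(V, W)) : 'Hom(V', W) :=
  (f \o g)%VF.
Definition postcomp_fun V W W' (h : 'Hom(W, W')) (f : 'Hom(V, W)) : 'Hom(V, W') :=
  (h \o f)%VF.

Lemma precomp_linear V V' W (g : 'Hom(V', V)) : linear (@precomp_fun V V' W g).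
Proof. by move=> c f f'; rewrite /precomp_fun comp_lfunDl comp_lfunZl. Qed.
Lemma postcomp_linear V W W' (h : 'Hom(W, W')) : linear (@postcomp_fun V W W' h).
Proof. by move=> c f f'; rewrite /postcomp_fun comp_lfunDr comp_lfunZr. Qed.

HB.instance Definition _ V V' W (g : 'Hom(V', V)) :=
  GRing.isLinear.Build k 'Hom(V, W) 'Hom(V', W) _
    (precomp_fun g) (@precomp_linear V V' W g).
HB.instance Definition _ V W W' (h : 'Hom(W, W')) :=
  GRing.isLinear.Build k 'Hom(V, W) 'Hom(V, W') _
    (postcomp_fun h) (@postcomp_linear V W W' h).

Definition precomp V V' W (g : 'Hom(V', V)) : 'Hom('Hom(V, W), 'Hom(V', W)) :=
  linfun (precomp_fun g).
Definition postcomp V W W' (h : 'Hom(W, W')) : 'Hom('Hom(V, W), 'Hom(V, W')) :=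
  linfun (postcomp_fun h).

Lemma precompE V V' W (g : 'Hom(V', V)) (f : 'Hom(V, W)) :
  precomp W g f = (f \o g)%VF.
Proof. by rewrite lfunE. Qed.
Lemma postcompE V W W' (h : 'Hom(W, W')) (f : 'Hom(V, W)) :
  postcomp V h f = (h \o f)%VF.
Proof. by rewrite lfunE. Qed.

End HomSpace.

(* Hom_k(M, Y) for an A-B-bimodule M and a C-D-bimodule Y is a B-D-bimodule,
   (b f d)(m) = f(m b) d, and a C-A-bimodule, (c f a)(m) = c f(a m). *)
Section KHom.
Variables (k : fieldType) (A B C D : falgType k).
Variables (M : bimod A B) (Y : bimod C D).

Definition klhom : bimod B D.
Proof.
refine (@Bimod k B D 'Hom(M, Y) (fun b => precomp Y (ract M b))
          (fun d => postcomp M (ract Y d)) _ _ _ _ _ _ _).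
- move=> c b b'; apply/lfunP => f; rewrite add_lfunE scale_lfunE !precompE.
  by rewrite ract_linear comp_lfunDr comp_lfunZr.
- move=> c b b'; apply/lfunP => f; rewrite add_lfunE scale_lfunE !postcompE.
  by rewrite ract_linear comp_lfunDl comp_lfunZl.
- by apply/lfunP => f; rewrite precompE ract1 comp_lfun1r id_lfunE.
- by apply/lfunP => f; rewrite postcompE ract1 comp_lfun1l id_lfunE.
- by move=> b b'; apply/lfunP => f; rewrite comp_lfunE !precompE ractM comp_lfunA.
- by move=> b b'; apply/lfunP => f; rewrite comp_lfunE !postcompE ractM comp_lfunA.
- move=> b d; apply/lfunP => f.
  by rewrite !comp_lfunE !precompE !postcompE comp_lfunA.
Defined.

Definition krhom : bimod C A.
Proof.
refine (@Bimod k C A 'Hom(M, Y) (fun c => postcomp M (lact Y c))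
          (fun a => precomp Y (lact M a)) _ _ _ _ _ _ _).
- move=> c b b'; apply/lfunP => f; rewrite add_lfunE scale_lfunE !postcompE.
  by rewrite lact_linear comp_lfunDl comp_lfunZl.
- move=> c b b'; apply/lfunP => f; rewrite add_lfunE scale_lfunE !precompE.
  by rewrite lact_linear comp_lfunDr comp_lfunZr.
- by apply/lfunP => f; rewrite postcompE lact1 comp_lfun1l id_lfunE.
- by apply/lfunP => f; rewrite precompE lact1 comp_lfun1r id_lfunE.
- by move=> b b'; apply/lfunP => f; rewrite comp_lfunE !postcompE lactM comp_lfunA.
- by move=> b b'; apply/lfunP => f; rewrite comp_lfunE !precompE lactM comp_lfunA.
- move=> c a; apply/lfunP => f.
  by rewrite !comp_lfunE !precompE !postcompE comp_lfunA.
Defined.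

End KHom.

(* Homomorphisms of left A-modules from an A-B- to an A-C-bimodule. *)
Section LHom.
Variables (k : fieldType) (A B C : falgType k) (M : bimod A B) (Y : bimod A C).

Definition lhom_space : {vspace klhom M Y} :=
  (\bigcap_(i < \dim {:A})
     lker (precomp Y (lact M (vbasis {:A})`_i)
           - postcomp M (lact Y (vbasis {:A})`_i)))%VS.

Lemma lhom_spaceP (f : 'Hom(M, Y)) :
  f \in lhom_space <-> forall a, (f \o lact M a = lact Y a \o f)%VF.
Proof.
rewrite memvE; split=> [/subv_bigcapP fA a|fA].
  apply/lfunP => m; rewrite !comp_lfunE (coord_vbasis (memvf a)).
  pose lM := GRing.isLinear.Build k A 'End(M) _ (lact M) (@lact_linear _ _ _ M).
  pose LM : {linear A -> 'End(M)} := HB.pack (lact M) lM.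
  pose lY := GRing.isLinear.Build k A 'End(Y) _ (lact Y) (@lact_linear _ _ _ Y).
  pose LY : {linear A -> 'End(Y)} := HB.pack (lact Y) lY.
  rewrite -[lact M]/(LM : A -> _) -[lact Y]/(LY : A -> _).
  rewrite !linear_sum !sum_lfunE linear_sum; apply: eq_bigr => i _.
  rewrite !linearZ /= !scale_lfunE linearZ /=; congr (_ *: _).
  have := fA i isT; rewrite -memvE => /eqlfunP.
  by rewrite precompE postcompE => /lfunP/(_ m); rewrite !comp_lfunE.
apply/subv_bigcapP => i _; rewrite -memvE; apply/eqlfunP.
by rewrite precompE postcompE fA.
Qed.

Lemma lhom_stable : stable_sub lhom_space.
Proof.
split=> c f /lhom_spaceP fA; apply/lhom_spaceP => a /=.
  by rewrite precompE -comp_lfunA -lractC comp_lfunA fA comp_lfunA.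
by rewrite postcompE -comp_lfunA fA comp_lfunA -lractC comp_lfunA.
Qed.

(* Hom_A(M, Y), a B-C-bimodule. *)
Definition lhom : bimod B C := submod lhom_stable.

Definition lhom_val (f : lhom) : 'Hom(M, Y) := vsval (f : subvs_of lhom_space).

Lemma lhom_lactE b f : lhom_val (lact lhom b f) = (lhom_val f \o ract M b)%VF.
Proof. by rewrite /lhom_val submod_lactE /= precompE. Qed.
Lemma lhom_ractE c f : lhom_val (ract lhom c f) = (ract Y c \o lhom_val f)%VF.
Proof. by rewrite /lhom_val submod_ractE /= postcompE. Qed.

End LHom.

(* Homomorphisms of right A-modules from a B-A- to a C-A-bimodule. *)
Section RHom.
Variables (k : fieldType) (A B C : falgType k) (M : bimod B A) (Y : bimod C A).

Definition rhom_space : {vspace krhom M Y} :=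
  (\bigcap_(i < \dim {:A})
     lker (precomp Y (ract M (vbasis {:A})`_i)
           - postcomp M (ract Y (vbasis {:A})`_i)))%VS.

Lemma rhom_spaceP (f : 'Hom(M, Y)) :
  f \in rhom_space <-> forall a, (f \o ract M a = ract Y a \o f)%VF.
Proof.
rewrite memvE; split=> [/subv_bigcapP fA a|fA].
  apply/lfunP => m; rewrite !comp_lfunE (coord_vbasis (memvf a)).
  pose lM := GRing.isLinear.Build k A 'End(M) _ (ract M) (@ract_linear _ _ _ M).
  pose LM : {linear A -> 'End(M)} := HB.pack (ract M) lM.
  pose lY := GRing.isLinear.Build k A 'End(Y) _ (ract Y) (@ract_linear _ _ _ Y).
  pose LY : {linear A -> 'End(Y)} := HB.pack (ract Y) lY.
  rewrite -[ract M]/(LM : A -> _) -[ract Y]/(LY : A -> _).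
  rewrite !linear_sum !sum_lfunE linear_sum; apply: eq_bigr => i _.
  rewrite !linearZ /= !scale_lfunE linearZ /=; congr (_ *: _).
  have := fA i isT; rewrite -memvE => /eqlfunP.
  by rewrite precompE postcompE => /lfunP/(_ m); rewrite !comp_lfunE.
apply/subv_bigcapP => i _; rewrite -memvE; apply/eqlfunP.
by rewrite precompE postcompE fA.
Qed.

Lemma rhom_stable : stable_sub rhom_space.
Proof.
split=> c f /rhom_spaceP fA; apply/rhom_spaceP => a /=.
  by rewrite postcompE -comp_lfunA fA comp_lfunA lractC comp_lfunA.
by rewrite precompE -comp_lfunA lractC comp_lfunA fA comp_lfunA.
Qed.

(* Hom_(A^op)(M, Y), a C-B-bimodule. *)
Definition rhom : bimod C B := submod rhom_stable.

Definition rhom_val (f : rhom) : 'Hom(M, Y) := vsval (f : subvs_of rhom_space).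

Lemma rhom_lactE c f : rhom_val (lact rhom c f) = (lact Y c \o rhom_val f)%VF.
Proof. by rewrite /rhom_val submod_lactE /= postcompE. Qed.
Lemma rhom_ractE b f : rhom_val (ract rhom b f) = (rhom_val f \o lact M b)%VF.
Proof. by rewrite /rhom_val submod_ractE /= precompE. Qed.

End RHom.

Section Biduality.
Variables (k : fieldType) (A B : falgType k) (X : bimod A B).

Definition ldual : bimod B A := lhom X (reg A).
Definition bidual : bimod A B := rhom ldual (reg A).

Definition eval_fun (x : X) (f : ldual) : reg A := lhom_val f x.

Lemma eval_linear x : linear (eval_fun x).
Proof.
by move=> c f g; rewrite /eval_fun /lhom_val linearP add_lfunE scale_lfunE.
Qed.

HB.instance Definition _ x :=
  GRing.isLinear.Build k ldual (reg A) _ (eval_fun x) (@eval_linear x).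

Lemma linfun_evalE x f : linfun (eval_fun x) f = lhom_val f x.
Proof. by rewrite lfunE. Qed.

Lemma eval_rhom x : linfun (eval_fun x) \in rhom_space ldual (reg A).
Proof.
apply/rhom_spaceP => a; apply/lfunP => f.
by rewrite !comp_lfunE !linfun_evalE lhom_ractE comp_lfunE.
Qed.

Definition biduality_fun (x : X) : bidual :=
  vsproj (rhom_space ldual (reg A)) (linfun (eval_fun x)).

Lemma biduality_funE x f : rhom_val (biduality_fun x) f = lhom_val f x.
Proof. by rewrite /rhom_val vsprojK ?eval_rhom // lfunE. Qed.

Lemma bidual_ext (u v : bidual) :
  (forall f, rhom_val u f = rhom_val v f) -> u = v.
Proof. by move=> uv; apply: subvs_inj; apply/lfunP. Qed.

Lemma biduality_linear : linear biduality_fun.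
Proof.
move=> c x y; apply: bidual_ext => f.
rewrite {2}/rhom_val linearP add_lfunE scale_lfunE -!/(rhom_val _).
by rewrite !biduality_funE linearP.
Qed.

HB.instance Definition _ :=
  GRing.isLinear.Build k X bidual _ biduality_fun biduality_linear.

Lemma linfun_bidualityE x : linfun biduality_fun x = biduality_fun x.
Proof. by rewrite lfunE. Qed.

(* The natural map X -> Hom_(A^op)(Hom_A(X, A), A), x |-> (f |-> f x). *)
Definition biduality : bihom X bidual.
Proof.
apply: (@mkhom _ _ _ X bidual (linfun biduality_fun)) => c x;
  rewrite !linfun_bidualityE; apply: bidual_ext => f.
  rewrite rhom_lactE comp_lfunE !biduality_funE.
  have /lhom_spaceP/(_ c)/lfunP/(_ x) := subvsP f.
  by rewrite !comp_lfunE.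
by rewrite rhom_ractE comp_lfunE !biduality_funE lhom_lactE comp_lfunE.
Defined.

Lemma bidualityE x f : rhom_val (biduality x) f = lhom_val f x.
Proof. by rewrite linfun_bidualityE biduality_funE. Qed.

End Biduality.

Section Projective.
Variables (k : fieldType) (A B : falgType k).
Implicit Types (X Y Z P : bimod A B).

Definition surjective X Y (f : bihom X Y) : Prop := forall y, exists x, f x = y.

Definition projective P : Prop :=
  forall Y Z (g : bihom Y Z) (f : bihom P Z), surjective g ->
    exists h : bihom P Y, forall x, g (h x) = f x.

Definition short_exact K P X (i : bihom K P) (p : bihom P X) : Prop :=
  [/\ injective i, limg i = lker p & surjective p].

Fixpoint pd_le (d : nat) X : Prop :=
  if d is d'.+1 then
    exists K P (i : bihom K P) (p : bihom P X),
      [/\ short_exact i p, projective P & pd_le d' K]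
  else projective X.

Definition finite_pd X : Prop := exists d, pd_le d X.

Record projres X := Projres {
  pr_ob : nat -> bimod A B;
  pr_diff : forall i, bihom (pr_ob i.+1) (pr_ob i);
  pr_aug : bihom (pr_ob 0) X;
  pr_proj : forall i, projective (pr_ob i);
  pr_aug_surj : surjective pr_aug;
  pr_exact0 : limg (pr_diff 0) = lker pr_aug;
  pr_exact : forall i, limg (pr_diff i.+1) = lker (pr_diff i)
}.

Definition cocycle X (P : projres X) Y i (f : bihom (pr_ob P i) Y) : Prop :=
  (f \o pr_diff P i)%VF = 0.

Definition coboundary X (P : projres X) Y i : bihom (pr_ob P i) Y -> Prop :=
  match i with
  | 0 => fun f => hfun f = 0
  | j.+1 => fun f => exists g : bihom (pr_ob P j) Y,
              hfun f = (g \o pr_diff P j)%VF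
  end.

(* Ext^i(X, Y) = 0, where Ext^i(X, Y) is the cohomology in degree i of
   Hom(P_*, Y) for a projective resolution P_* of X.  Resolutions exist (see
   [free_res]) and the cohomology does not depend on P_*, so quantifying over
   all of them is the same as choosing one. *)
Definition Ext_vanishes (i : nat) X Y : Prop :=
  forall (P : projres X) (f : bihom (pr_ob P i) Y), cocycle f -> coboundary f.

Lemma projective_retract P Q (i : bihom P Q) (r : bihom Q P) :
  (forall x, r (i x) = x) -> projective Q -> projective P.
Proof.
move=> ri pQ Y Z g f gs; have [h gh] := pQ _ _ g (comphom f r) gs.
by exists (comphom h i) => x; rewrite comp_lfunE gh comp_lfunE ri.
Qed.

Lemma lfun_section X Z (g : bihom X Z) :
  surjective g -> forall z, g ((hfun g)^-1%VF z) = z.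
Proof.
by move=> gs z; apply: limg_lfunVK; have [x <-] := gs z; rewrite memv_img ?memvf.
Qed.

End Projective.

Definition infinite_gldim (k : fieldType) (A : falgType k) : Prop :=
  forall d, exists X : lmod A, ~ pd_le d X.

(* M (x)_B - preserves projectives when M is projective as a left A-module, by
   the adjunction with Hom_A(M, -). *)
Section TensorProjective.
Variables (k : fieldType) (A B C : falgType k) (M : bimod A B).
Implicit Types (X Y Z : bimod A C) (P : bimod B C).

Definition lres_hom X Y (f : bihom X Y) : bihom (lres X) (lres Y).
Proof.
apply: (@mkhom _ _ _ (lres X) (lres Y) (hfun f)) => c x.
  exact: (hom_lactE f).
by rewrite /= !scale_lfunE !id_lfunE linearZ.
Defined.

Lemma lhom_ext Y (u v : lhom M Y) :
  (forall m, lhom_val u m = lhom_val v m) -> u = v.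
Proof. by move=> uv; apply: subvs_inj; apply/lfunP. Qed.

Lemma lhom_hom Y (u : lhom M Y) a m :
  lhom_val u (lact M a m) = lact Y a (lhom_val u m).
Proof.
by have /lhom_spaceP/(_ a)/lfunP/(_ m) := subvsP u; rewrite !comp_lfunE.
Qed.

Lemma lhom_valP Y c (u v : lhom M Y) m :
  lhom_val (c *: u + v) m = c *: lhom_val u m + lhom_val v m.
Proof. by rewrite /lhom_val linearP add_lfunE scale_lfunE. Qed.

Lemma lhom_mk Y (f : 'Hom(M, Y)) :
  (forall a m, f (lact M a m) = lact Y a (f m)) ->
  exists u : lhom M Y, lhom_val u = f.
Proof.
move=> fA; exists (vsproj (lhom_space M Y) f); rewrite /lhom_val vsprojK //.
by apply/lhom_spaceP => a; apply/lfunP => m; rewrite !comp_lfunE fA.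
Qed.

Lemma curry P Z (phi : P -> M -> Z) :
  bilin phi ->
  (forall a p m, phi p (lact M a m) = lact Z a (phi p m)) ->
  (forall b p m, phi (lact P b p) m = phi p (ract M b m)) ->
  (forall c p m, phi (ract P c p) m = ract Z c (phi p m)) ->
  exists f : bihom P (lhom M Z), forall p m, lhom_val (f p) m = phi p m.
Proof.
move=> [phil phir] phiA phiB phiC.
pose F p : lhom M Z := vsproj (lhom_space M Z) (mklfun (phir p)).
have FE p m : lhom_val (F p) m = phi p m.
  rewrite /lhom_val vsprojK ?mklfunE //; apply/lhom_spaceP => a.
  by apply/lfunP => x; rewrite !comp_lfunE !mklfunE phiA.
have FL : linear F.
  by move=> c p p'; apply: lhom_ext => m; rewrite lhom_valP !FE phil.
have GE p m : lhom_val (mklfun FL p) m = phi p m by rewrite mklfunE FE.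
unshelve eexists; first apply: (@mkhom _ _ _ P (lhom M Z) (mklfun FL)) => [b p|c p].
- by apply: lhom_ext => m; rewrite lhom_lactE comp_lfunE !GE phiB.
- by apply: lhom_ext => m; rewrite lhom_ractE comp_lfunE !GE phiC.
- exact: GE.
Qed.

Lemma tens_projective P :
  projective (lres M) -> projective P -> projective (tens M P).
Proof.
move=> pM pP Y Z g f gs.
have [pl pr] := tens_pure_bilin M P.
have [f' f'E] : exists f' : bihom P (lhom M Z),
    forall p m, lhom_val (f' p) m = f (tens_pure m p).
  apply: curry => [|a p m|b p m|c p m].
  - by split=> [m|p] c u v; rewrite ?pl ?pr linearP.
  - by rewrite -lact_pure hom_lactE.
  - by rewrite tens_balanced.
  - by rewrite -ract_pure hom_ractE.
have [g' g'E] : exists g' : bihom (lhom M Y) (lhom M Z),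
    forall u m, lhom_val (g' u) m = g (lhom_val u m).
  apply: curry => [|a u m|b u m|c u m].
  - by split=> [m|u] c x y; rewrite ?lhom_valP linearP // linearP.
  - by rewrite lhom_hom hom_lactE.
  - by rewrite lhom_lactE comp_lfunE.
  - by rewrite lhom_ractE comp_lfunE hom_ractE.
have g's : surjective g'.
  move=> u.
  have ul c m : lhom_val u (ract (lres M) c m) = ract (lres Z) c (lhom_val u m).
    by rewrite /= !scale_lfunE !id_lfunE linearZ.
  pose v := @mkhom _ _ _ (lres M) (lres Z) (lhom_val u) (@lhom_hom Z u) ul.
  have [w wE] := pM _ _ (lres_hom g) v gs.
  have [w' w'E] := @lhom_mk Y (hfun w) (fun a m => hom_lactE w a m).
  exists w'; apply: lhom_ext => m.
  by rewrite g'E w'E; apply: wE.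
have [h hE] := pP _ _ g' f' g's.
have hb : bilin (fun (m : M) (p : P) => lhom_val (h p) m).
  by split=> [p|m] c x y; rewrite ?linearP ?lhom_valP.
have hbal b m p : lhom_val (h p) (ract M b m) = lhom_val (h (lact P b p)) m.
  by rewrite hom_lactE lhom_lactE comp_lfunE.
have H := tens_liftE hb hbal.
unshelve eexists; first exists (tens_lift (fun m p => lhom_val (h p) m)) => c.
- apply: tens_ext => m p; rewrite !comp_lfunE lact_pure !H.
  by rewrite lhom_hom.
- apply: tens_ext => m p; rewrite !comp_lfunE ract_pure !H.
  by rewrite hom_ractE lhom_ractE comp_lfunE.
move=> x /=; rewrite -comp_lfunE; move: x; apply/lfunP; apply: tens_ext => m p.
by rewrite comp_lfunE H -g'E hE f'E.
Qed.

End TensorProjective.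

Section Syzygy.
Variables (k : fieldType) (A B : falgType k).
Implicit Types (X Y Z P : bimod A B).

Definition free_on X : bimod A B := ktens (ktens (reg A) X) (reg B).

Definition free_pure X (a : A) (x : X) (b : B) : free_on X :=
  @tpure k (ktens (reg A) X) (reg B) (@tpure k (reg A) X a x) b.

Lemma free_ext X (Z : vectType k) (f g : 'Hom(free_on X, Z)) :
  (forall a x b, f (free_pure a x b) = g (free_pure a x b)) -> f = g.
Proof.
move=> fg; apply: tspace_ext => t b.
pose i := mklfun ((tpure_bilin (ktens (reg A) X) (reg B)).1 b).
have : (f \o i = g \o i)%VF.
  by apply: tspace_ext => a x; rewrite !comp_lfunE !mklfunE; apply: fg.
by move=> /lfunP/(_ t); rewrite !comp_lfunE !mklfunE.
Qed.

Lemma lact_free X c a (x : X) b :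
  lact (free_on X) c (free_pure a x b) = free_pure (c * a) x b.
Proof. by rewrite /free_pure /= tmapE /= tmapE !id_lfunE /= lfunE. Qed.

Lemma ract_free X c a (x : X) b :
  ract (free_on X) c (free_pure a x b) = free_pure a x (b * c).
Proof. by rewrite /free_pure /= tmapE /= id_lfunE lfunE. Qed.

Definition free_lift_lfun X Z (s : 'Hom(X, Z)) : 'Hom(free_on X, Z) :=
  @tlift k (ktens (reg A) X) (reg B) Z (fun t b =>
    ract Z b (@tlift k (reg A) X Z (fun a x => lact Z a (s x)) t)).

Lemma free_lift_lfunE X Z (s : 'Hom(X, Z)) a x b :
  free_lift_lfun s (free_pure a x b) = ract Z b (lact Z a (s x)).
Proof.
rewrite /free_lift_lfun /free_pure tliftE.
  rewrite tliftE //; split=> [y|a'] c u v; last by rewrite !linearP.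
  exact: lactPE.
split=> [b'|t] c u v; first by rewrite !linearP.
exact: ractPE.
Qed.

Definition free_lift X Z (s : 'Hom(X, Z)) : bihom (free_on X) Z.
Proof.
exists (free_lift_lfun s) => c; apply: free_ext => a x b; rewrite !comp_lfunE.
  by rewrite lact_free !free_lift_lfunE lactME lractCE.
by rewrite ract_free !free_lift_lfunE ractME.
Defined.

Lemma free_liftE X Z (s : 'Hom(X, Z)) a x b :
  free_lift s (free_pure a x b) = ract Z b (lact Z a (s x)).
Proof. exact: free_lift_lfunE. Qed.

Definition free_map_lfun X Y (f : 'Hom(X, Y)) : 'Hom(free_on X, free_on Y) :=
  @tmap k (ktens (reg A) X) (ktens (reg A) Y) (reg B) (reg B)
    (@tmap k (reg A) (reg A) X Y \1%VF f) \1%VF.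

Lemma free_map_lfunE X Y (f : 'Hom(X, Y)) a x b :
  free_map_lfun f (free_pure a x b) = free_pure a (f x) b.
Proof. by rewrite /free_map_lfun !tmapE !id_lfunE. Qed.

Definition free_map X Y (f : bihom X Y) : bihom (free_on X) (free_on Y).
Proof.
exists (free_map_lfun f) => c; apply: free_ext => a x b; rewrite !comp_lfunE.
  rewrite (free_map_lfunE f a x b) (lact_free c a (f x) b).
  by rewrite (lact_free c a x b) (free_map_lfunE f (c * a) x b).
rewrite (free_map_lfunE f a x b) (ract_free c a (f x) b).
by rewrite (ract_free c a x b) (free_map_lfunE f a x (b * c)).
Defined.

Lemma free_mapE X Y (f : bihom X Y) a x b :
  free_map f (free_pure a x b) = free_pure a (f x) b.
Proof. exact: free_map_lfunE. Qed.

(* The functorial free cover a (x) x (x) b |-> a x b of X. *)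
Definition cover X : bihom (free_on X) X := free_lift \1%VF.

Lemma coverE X a x b : cover X (free_pure a x b) = ract X b (lact X a x).
Proof. by rewrite free_liftE id_lfunE. Qed.

Lemma cover_surj X : surjective (cover X).
Proof. by move=> x; exists (free_pure 1 x 1); rewrite coverE lact1E ract1E. Qed.

Lemma cover_nat X Y (f : bihom X Y) x : cover Y (free_map f x) = f (cover X x).
Proof.
rewrite -!comp_lfunE; move: x; apply/lfunP; apply: free_ext => a x b.
by rewrite !comp_lfunE free_mapE !coverE hom_ractE hom_lactE.
Qed.

Lemma free_projective X : projective (free_on X).
Proof.
move=> Y Z g f gs.
have L : linear (fun x : X => (hfun g)^-1%VF (f (free_pure 1 x 1))).
  move=> c x y; rewrite /free_pure tpurePr tpurePl linearP.
  by rewrite linearP.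
exists (free_lift (mklfun L)) => x; rewrite -!comp_lfunE; move: x; apply/lfunP.
apply: free_ext => a x b; rewrite comp_lfunE free_liftE mklfunE.
rewrite hom_ractE hom_lactE lfun_section // -hom_lactE -hom_ractE.
by rewrite lact_free ract_free mulr1 mul1r.
Qed.

Lemma ker_stable X Y (f : bihom X Y) : stable_sub (lker f).
Proof.
split=> c x; rewrite !memv_ker => /eqP fx0.
  by rewrite hom_lactE fx0 linear0.
by rewrite hom_ractE fx0 linear0.
Qed.

(* The syzygy of X, taken with respect to its functorial free cover; in the
   stable category it is isomorphic to the kernel of any surjection
   from a projective onto X. *)
Definition syz X : bimod A B := submod (ker_stable (cover X)).

Definition syz_val X (u : syz X) : free_on X :=
  vsval (u : subvs_of (lker (cover X))).

Lemma syz_valK X (u : syz X) : cover X (syz_val u) = 0.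
Proof. by apply/eqP; rewrite -memv_ker subvsP. Qed.

Lemma syz_ext X (u v : syz X) : syz_val u = syz_val v -> u = v.
Proof. exact: subvs_inj. Qed.

Lemma syz_valP X c (u v : syz X) :
  syz_val (c *: u + v) = c *: syz_val u + syz_val v.
Proof. by rewrite /syz_val linearP. Qed.

Lemma syz_val_lact X a (u : syz X) :
  syz_val (lact (syz X) a u) = lact (free_on X) a (syz_val u).
Proof. exact: submod_lactE. Qed.

Lemma syz_val_ract X b (u : syz X) :
  syz_val (ract (syz X) b u) = ract (free_on X) b (syz_val u).
Proof. exact: submod_ractE. Qed.

Definition syz_corestrict_fun X Y (f : bihom Y (free_on X)) (y : Y) : syz X :=
  vsproj (lker (cover X)) (f y).

Lemma syz_corestrict_funE X Y (f : bihom Y (free_on X)) y :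
  cover X (f y) = 0 -> syz_val (syz_corestrict_fun f y) = f y.
Proof. by move=> f0; rewrite /syz_val vsprojK // memv_ker f0. Qed.

Lemma syz_corestrict_linear X Y (f : bihom Y (free_on X)) :
  linear (syz_corestrict_fun f).
Proof. by move=> c x y; rewrite /syz_corestrict_fun !linearP. Qed.

(* A homomorphism to free_on X killed by the cover, as one to syz X. *)
Definition syz_corestrict X Y (f : bihom Y (free_on X))
  (f0 : forall y, cover X (f y) = 0) : bihom Y (syz X).
Proof.
apply: (@mkhom _ _ _ Y (syz X) (mklfun (syz_corestrict_linear f))) => c y;
  apply: syz_ext; rewrite !mklfunE.
  by rewrite syz_val_lact !syz_corestrict_funE ?f0 // hom_lactE.
by rewrite syz_val_ract !syz_corestrict_funE ?f0 // hom_ractE.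
Defined.

Lemma syz_corestrictE X Y (f : bihom Y (free_on X))
    (f0 : forall y, cover X (f y) = 0) y :
  syz_val (syz_corestrict f0 y) = f y.
Proof. by rewrite /= mklfunE syz_corestrict_funE. Qed.

Definition syz_incl X : bihom (syz X) (free_on X) :=
  subincl (ker_stable (cover X)).

Lemma syz_inclE X (u : syz X) : syz_incl X u = syz_val u.
Proof. by rewrite /= lfunE. Qed.

Lemma syz_map_subproof X Y (f : bihom X Y) (u : syz X) :
  cover Y (comphom (free_map f) (syz_incl X) u) = 0.
Proof. by rewrite comp_lfunE cover_nat syz_inclE syz_valK linear0. Qed.

(* The map induced by id (x) f (x) id on the kernels of the covers. *)
Definition syz_map X Y (f : bihom X Y) : bihom (syz X) (syz Y) :=
  syz_corestrict (syz_map_subproof f).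

Lemma syz_mapE X Y (f : bihom X Y) u :
  syz_val (syz_map f u) = free_map f (syz_val u).
Proof. by rewrite syz_corestrictE comp_lfunE syz_inclE. Qed.

Lemma syz_projective P : projective P -> projective (syz P).
Proof.
move=> pP; have [s sK] := pP _ _ (cover P) (idhom P) (@cover_surj P).
pose r := addhom (idhom (free_on P)) (opphom (comphom s (cover P))).
have rE x : r x = x - s (cover P x).
  by rewrite add_lfunE opp_lfunE comp_lfunE id_lfunE.
have r0 x : cover P (r x) = 0.
  by rewrite rE linearB /= sK id_lfunE subrr.
apply: (@projective_retract _ _ _ _ _ (syz_incl P) (syz_corestrict r0)).
  move=> u; apply: syz_ext; rewrite syz_corestrictE rE syz_inclE.
  by rewrite syz_valK linear0 subr0.
exact: free_projective.
Qed.

End Syzygy.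

(* Categories whose morphisms are considered up to an equivalence relation
   [heq], so that a quotient category is obtained by changing [heq] only. *)
Record category := Category {
  ob :> Type;
  hom : ob -> ob -> Type;
  heq : forall X Y, hom X Y -> hom X Y -> Prop;
  ident : forall X, hom X X;
  comp : forall X Y Z, hom Y Z -> hom X Y -> hom X Z;
  heq_refl : forall X Y (f : hom X Y), heq f f;
  heq_sym : forall X Y (f g : hom X Y), heq f g -> heq g f;
  heq_trans : forall X Y (f g h : hom X Y), heq f g -> heq g h -> heq f h;
  comp_heq : forall X Y Z (g g' : hom Y Z) (f f' : hom X Y),
    heq g g' -> heq f f' -> heq (comp g f) (comp g' f');
  compA : forall X Y Z W (h : hom Z W) (g : hom Y Z) (f : hom X Y),
    heq (comp h (comp g f)) (comp (comp h g) f);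
  comp1l : forall X Y (f : hom X Y), heq (comp (ident Y) f) f;
  comp1r : forall X Y (f : hom X Y), heq (comp f (ident X)) f
}.
Arguments hom {c} _ _.
Arguments heq {c X Y} _ _.
Arguments ident {c} _.
Arguments comp {c X Y Z} _ _.

Record functor (C D : category) := Functor {
  fob :> C -> D;
  fmap : forall X Y, hom X Y -> hom (fob X) (fob Y);
  fmap_heq : forall X Y (f g : hom X Y), heq f g -> heq (fmap f) (fmap g);
  fmap1 : forall X, heq (fmap (ident X)) (ident (fob X));
  fmapM : forall X Y Z (g : hom Y Z) (f : hom X Y),
    heq (fmap (comp g f)) (comp (fmap g) (fmap f))
}.
Arguments fmap {C D} _ {X Y} _.

Definition is_iso (C : category) (X Y : C) (f : hom X Y) : Prop :=
  exists g : hom Y X, heq (comp g f) (ident X) /\ heq (comp f g) (ident Y).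

Definition isomorphic (C : category) (X Y : C) : Prop :=
  exists f : hom X Y, is_iso f.

Definition nat_iso (C D : category) (F G : functor C D) : Prop :=
  exists eta : forall X, hom (F X) (G X),
    (forall X, is_iso (eta X)) /\
    (forall X Y (f : hom X Y),
       heq (comp (eta Y) (fmap F f)) (comp (fmap G f) (eta X))).

Definition id_functor (C : category) : functor C C.
Proof. refine (@Functor C C id (fun _ _ f => f) _ _ _).
- by [].
- by move=> X; apply: heq_refl.
- by move=> X Y Z g f; apply: heq_refl.
Defined.

Definition comp_functor (C D E : category) (G : functor D E) (F : functor C D) :
  functor C E.
Proof.
refine (@Functor C E (fun X => G (F X)) (fun _ _ f => fmap G (fmap F f)) _ _ _).
- by move=> X Y f g fg; do 2!apply: fmap_heq.
- by move=> X; apply: heq_trans (fmap1 G _); apply/fmap_heq/fmap1.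
- by move=> X Y Z g f; apply: heq_trans (fmapM G _ _); apply/fmap_heq/fmapM.
Defined.

Fixpoint iter_functor (C : category) (n : nat) (F : functor C C) : functor C C :=
  if n is n'.+1 then comp_functor F (iter_functor n' F) else id_functor C.

(* The usual notion is S = T = id.  A singular equivalence of level n gives
   functors whose composites are Omega^n, which is an autoequivalence of the
   stable category of modules of Gorenstein dimension zero but not the identity
   in general: for S = Omega^n, an inverse of F is Omega^(-n) G. *)
Definition quasi_inverse_up_to (C D : category) (F : functor C D)
    (G : functor D C) (S : functor C C) (T : functor D D) : Prop :=
  nat_iso (comp_functor G F) S /\ nat_iso (comp_functor F G) T.

Definition quasi_inverse (C D : category) (F : functor C D) (G : functor D C) :
    Prop :=
  quasi_inverse_up_to F G (id_functor C) (id_functor D).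

Definition is_equivalence (C D : category) (F : functor C D) : Prop :=
  exists G : functor D C, quasi_inverse F G.

Definition full (C : category) (P : C -> Prop) : category.
Proof.
refine (@Category {X : C | P X} (fun X Y => hom (sval X) (sval Y))
          (fun _ _ f g => heq f g) (fun X => ident (sval X))
          (fun _ _ _ g f => comp g f) _ _ _ _ _ _ _).
- by move=> *; exact: heq_refl.
- by move=> *; exact: heq_sym.
- by move=> X Y f g h; exact: heq_trans.
- by move=> *; exact: comp_heq.
- by move=> *; exact: compA.
- by move=> *; exact: comp1l.
- by move=> *; exact: comp1r.
Defined.

Definition full_functor (C D : category) (P : C -> Prop) (Q : D -> Prop)
  (F : functor C D) (FPQ : forall X, P X -> Q (F X)) :
  functor (full P) (full Q).
Proof.
refine (@Functor (full P) (full Q)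
  (fun X => exist _ (F (sval X)) (FPQ _ (svalP X))) (fun _ _ f => fmap F f) _ _ _).
- by move=> X Y f g; apply: (@fmap_heq _ _ F).
- by move=> X; apply: (@fmap1 _ _ F).
- by move=> X Y Z g f; apply: (@fmapM _ _ F).
Defined.

Section Stable.
Variables (k : fieldType) (A B : falgType k).
Implicit Types (X Y Z P : bimod A B).

Definition stable_eq X Y (f g : bihom X Y) : Prop :=
  exists P (u : bihom X P) (v : bihom P Y),
    projective P /\ hfun f - hfun g = (v \o u)%VF.

Lemma stable_eqP X Y (f g : bihom X Y) :
  stable_eq f g <->
  exists w : bihom X (free_on Y), hfun f - hfun g = (cover Y \o w)%VF.
Proof.
split=> [[P [u [v [pP e]]]]|[w e]]; last first.
  by exists (free_on Y), w, (cover Y); split=> //; exact: free_projective.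
have [h hv] := pP _ _ (cover Y) v (@cover_surj _ _ _ Y).
exists (comphom h u); rewrite e; apply/lfunP => x.
by rewrite !comp_lfunE hv.
Qed.

Lemma stable_eq_hfun X Y (f g : bihom X Y) : hfun f = hfun g -> stable_eq f g.
Proof.
move=> fg; apply/stable_eqP; exists (zerohom X (free_on Y)).
by rewrite fg subrr comp_lfun0r.
Qed.

Lemma stable_eq_sym X Y (f g : bihom X Y) : stable_eq f g -> stable_eq g f.
Proof.
move=> [P [u [v [pP e]]]]; exists P, u, (opphom v); split=> //.
by rewrite /= comp_lfunNl -e opprB.
Qed.

Lemma stable_eq_trans X Y (f g h : bihom X Y) :
  stable_eq f g -> stable_eq g h -> stable_eq f h.
Proof.
move=> /stable_eqP [u eu] /stable_eqP [v ev]; apply/stable_eqP.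
by exists (addhom u v); rewrite comp_lfunDr -eu -ev addrA subrK.
Qed.

Lemma stable_eq_comp X Y Z (g g' : bihom Y Z) (f f' : bihom X Y) :
  stable_eq g g' -> stable_eq f f' -> stable_eq (comphom g f) (comphom g' f').
Proof.
move=> [P [u [v [pP e]]]] [Q [u' [v' [pQ e']]]].
apply: (@stable_eq_trans _ _ _ (comphom g f')).
  exists Q, u', (comphom g v'); split=> //=.
  by rewrite -comp_lfunA -e' comp_lfunDr comp_lfunNr.
exists P, (comphom u f'), v; split=> //=.
by rewrite comp_lfunA -e comp_lfunDl comp_lfunNl.
Qed.

Definition stab : category.
Proof.
refine (@Category (bimod A B) (@bihom k A B) stable_eq (@idhom k A B)
          (@comphom k A B) _ _ _ _ _ _ _).
- by move=> X Y f; apply: stable_eq_hfun.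
- exact: stable_eq_sym.
- exact: stable_eq_trans.
- exact: stable_eq_comp.
- by move=> X Y Z W h g f; apply: stable_eq_hfun; apply: comp_lfunA.
- by move=> X Y f; apply: stable_eq_hfun; apply: comp_lfun1l.
- by move=> X Y f; apply: stable_eq_hfun; apply: comp_lfun1r.
Defined.

Lemma free_map_comp X Y Z (g : bihom Y Z) (f : bihom X Y) x :
  free_map (comphom g f) x = free_map g (free_map f x).
Proof.
rewrite -[RHS]comp_lfunE; move: x; apply/lfunP; apply: free_ext => a x b.
by rewrite [RHS]comp_lfunE !free_mapE comp_lfunE.
Qed.

Lemma free_map1 X x : free_map (idhom X) x = x.
Proof.
rewrite -[RHS]id_lfunE; move: x; apply/lfunP; apply: free_ext => a x b.
by rewrite id_lfunE free_mapE id_lfunE.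
Qed.

Lemma free_pureB X a (x y : X) b :
  free_pure a x b - free_pure a y b = free_pure a (x - y) b :> free_on X.
Proof.
by rewrite /free_pure [x - y]addrC -[- y]scaleN1r tpurePr tpurePl scaleN1r addrC.
Qed.

Lemma free_mapB X Y (f g h : bihom X Y) : hfun f - hfun g = hfun h ->
  forall x, free_map f x - free_map g x = free_map h x.
Proof.
move=> e x; rewrite -opp_lfunE -add_lfunE; move: x; apply/lfunP.
apply: free_ext => a x b; rewrite add_lfunE opp_lfunE !free_mapE -e.
by rewrite add_lfunE opp_lfunE free_pureB.
Qed.

Definition syz_functor : functor stab stab.
Proof.
refine (@Functor stab stab (@syz k A B) (@syz_map k A B) _ _ _).
- move=> X Y f g [P [u [v [pP e]]]].
  exists (syz P), (syz_map u), (syz_map v); split; first exact: syz_projective.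
  apply/lfunP => x; apply: syz_ext; rewrite add_lfunE opp_lfunE comp_lfunE.
  rewrite addrC -scaleN1r syz_valP !syz_mapE scaleN1r addrC.
  by rewrite -free_map_comp; apply: free_mapB.
- move=> X; apply: stable_eq_hfun; apply/lfunP => x; apply: syz_ext.
  by rewrite syz_mapE free_map1 id_lfunE.
- move=> X Y Z g f; apply: stable_eq_hfun; apply/lfunP => x; apply: syz_ext.
  by rewrite comp_lfunE !syz_mapE free_map_comp.
Defined.

End Stable.

Definition tens_functor (k : fieldType) (A B C : falgType k) (M : bimod A B)
  (pM : projective (lres M)) : functor (stab B C) (stab A C).
Proof.
refine (@Functor (stab B C) (stab A C) (@tens k A B C M) (@tensmap k A B C M) _ _ _).
- move=> X Y f g [P [u [v [pP e]]]].
  exists (tens M P), (tensmap M u), (tensmap M v).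
  split; first exact: tens_projective.
  apply: tens_ext => m x; rewrite add_lfunE opp_lfunE comp_lfunE !tensmapE.
  have [_ pr] := tens_pure_bilin M Y.
  rewrite -comp_lfunE -e add_lfunE opp_lfunE addrC -scaleN1r -pr.
  by rewrite scaleN1r addrC.
- move=> X; apply: stable_eq_hfun; apply: tens_ext => m x.
  by rewrite tensmapE !id_lfunE.
- move=> X Y Z g f; apply: stable_eq_hfun; apply: tens_ext => m x.
  by rewrite comp_lfunE !tensmapE comp_lfunE.
Defined.

Section FreeResolution.
Variables (k : fieldType) (A B : falgType k) (X : bimod A B).

Let res_diff i := comphom (syz_incl (iter i (@syz k A B) X))
                    (cover (iter i.+1 (@syz k A B) X)).

Let limg_res_diff i : limg (res_diff i) = lker (cover (iter i (@syz k A B) X)).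
Proof.
apply/vspaceP => y; rewrite memv_ker; apply/memv_imgP/eqP => [[x _ ->]|y0].
  by rewrite comp_lfunE syz_inclE syz_valK.
have yK : y \in lker (cover (iter i (@syz k A B) X)) by rewrite memv_ker y0.
have [x xE] := cover_surj (Subvs yK : syz (iter i (@syz k A B) X)).
by exists x; rewrite ?memvf // comp_lfunE syz_inclE xE.
Qed.

Definition free_res : projres X.
Proof.
refine (@Projres k A B X (fun i => free_on (iter i (@syz k A B) X))
          res_diff (cover X) _ _ _ _).
- by move=> i; apply: free_projective.
- exact: cover_surj.
- exact: (limg_res_diff 0).
- move=> i; rewrite limg_res_diff; apply/vspaceP => y.
  rewrite !memv_ker comp_lfunE syz_inclE; apply/eqP/eqP => [->|y0].
    by rewrite /syz_val linear0.
  by apply: syz_ext; rewrite y0 /syz_val linear0.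
Defined.

End FreeResolution.

Record gdim0 (k : fieldType) (A : falgType k) (X : lmod A) : Prop := Gdim0 {
  gdim0_reflexive : bijective (biduality X);
  gdim0_Ext : forall i, (0 < i)%N -> Ext_vanishes i X (lres (reg A));
  gdim0_Ext_dual : forall i, (0 < i)%N ->
    Ext_vanishes i (ldual X) (rres (reg A))
}.

Definition gstab (k : fieldType) (A : falgType k) : category :=
  @full (stab A k^o) (@gdim0 k A).

Record singular_equivalence (k : fieldType) (A B : falgType k) (n : nat)
    (M : bimod A B) (N : bimod B A) : Prop := SingularEquivalence {
  se_projMl : projective (lres M);
  se_projMr : projective (rres M);
  se_projNl : projective (lres N);
  se_projNr : projective (rres N);
  se_MN : @isomorphic (stab A A) (tens M N) (iter n (@syz k A A) (reg A));
  se_NM : @isomorphic (stab B B) (tens N M) (iter n (@syz k B B) (reg B))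
}.

(* Main.v *)
From mathcomp Require Import all_boot all_algebra falgebra.
Require Import Defs.
From Stdlib Require Import IndefiniteDescription Setoid Morphisms.

(** Write G(A) for the A-modules of Gorenstein dimension zero.

    A module X lies in G(A) exactly if it belongs to a class of modules that
    have no Ext into A in positive degrees and embed into projective modules
    with cokernel in the class ([gdim0_gproj], [gproj_gdim0]): iterating the
    embeddings and taking a projective resolution gives the complete resolution
    of X.  This description involves left modules only, and it is inherited by
    M (x)_B X.  Indeed M (x)_B - is exact because M is projective on the right,
    it preserves projectives because M is projective on the left, and
    Ext^j_A(M (x)_B X, A) = Ext^j_B(X, Hom_A(M, A)) = 0, since a module with no
    Ext into B has none into modules of finite projective dimension
    ([tens_gproj]).

    On the stable category of G(A), Omega is fully faithful, because maps from a
    syzygy of X to a projective module extend to the cover of X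
    ([syz_functor_full], [syz_functor_faithful]), and dense, because X is a
    syzygy of its cokernel in a projective module ([syz_functor_dense]).

    The composite of the two tensor functors is, stably and naturally in X,
    N (x) (M (x) X) = (N (x) M) (x) X = Omega^n(B) (x) X = Omega^n(X).  The middle
    step uses that projective bimodules tensored with X are projective; the last
    one that bimodule syzygies of B are projective on the right, so that their
    presentations split there and stay exact after tensoring
    ([tens_iter_syz_natural]).  Hence both composites are isomorphic to
    equivalences, which forces each of the two functors to be fully faithful and
    dense ([weak_equivalence_two_sided]); an inverse is then obtained by choice
    ([weak_equivalence_is_equivalence]).

    Ext groups enter only through their vanishing, as the possibility of
    extending homomorphisms from the kernel of a presentation.  This does not
    depend on the presentation ([extension_transfer]) and passes to stable
    retracts ([ext1_stable_retract]), which replaces comparison of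
    resolutions. *)

Set Implicit Arguments.
Unset Strict Implicit.
Unset Printing Implicit Defensive.

Import GRing.Theory VectorInternalTheory.
Local Open Scope ring_scope.

(** * Homomorphisms and short exact sequences *)

Section Homs.
Variables (k : fieldType) (A B : falgType k).
Implicit Types (X Y Z P K E : bimod A B).

Lemma addhomE X Y (f g : bihom X Y) x : addhom f g x = f x + g x.
Proof. by rewrite add_lfunE. Qed.

Lemma opphomE X Y (f : bihom X Y) x : opphom f x = - f x.
Proof. by rewrite opp_lfunE. Qed.

Lemma comphomE X Y Z (g : bihom Y Z) (f : bihom X Y) x :
  comphom g f x = g (f x).
Proof. by rewrite comp_lfunE. Qed.

Lemma idhomE X x : idhom X x = x.
Proof. by rewrite id_lfunE. Qed.

Definition bihomE := (comphomE, idhomE, addhomE, opphomE).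

Lemma bihom_of_fun X Y (phi : X -> Y) : linear phi ->
  (forall a x, phi (lact X a x) = lact Y a (phi x)) ->
  (forall b x, phi (ract X b x) = ract Y b (phi x)) ->
  exists f : bihom X Y, forall x, f x = phi x.
Proof.
move=> L l r; unshelve eexists.
  by apply: (@mkhom _ _ _ X Y (mklfun L)) => c x; rewrite !mklfunE.
by move=> x /=; rewrite mklfunE.
Qed.

Lemma factor_epi X P Y (p : bihom P X) (f : bihom P Y) :
  surjective p -> (forall x, p x = 0 -> f x = 0) ->
  exists g : bihom X Y, forall x, g (p x) = f x.
Proof.
move=> ps f0; pose phi := (hfun f \o (hfun p)^-1)%VF.
have phiE x : phi (p x) = f x.
  rewrite comp_lfunE; apply/eqP; rewrite -subr_eq0 -linearB /= f0 //.
  by rewrite linearB /= lfun_section // subrr.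
have [||c x|g gE] := @bihom_of_fun X Y phi.
- exact: linearP.
- by move=> a x; have [y <-] := ps x; rewrite -hom_lactE !phiE hom_lactE.
- by have [y <-] := ps x; rewrite -hom_ractE !phiE hom_ractE.
by exists g => x; rewrite gE.
Qed.

Lemma factor_mono K P Y (i : bihom K P) (f : bihom Y P) :
  injective i -> (forall y, exists x, i x = f y) ->
  exists g : bihom Y K, forall y, i (g y) = f y.
Proof.
move=> ii fi; pose phi := ((hfun i)^-1 \o hfun f)%VF.
have phiE y : i (phi y) = f y.
  by rewrite comp_lfunE limg_lfunVK //; have [x <-] := fi y; rewrite memv_img ?memvf.
have [||c x|g gE] := @bihom_of_fun Y K phi.
- exact: linearP.
- by move=> a x; apply: ii; rewrite hom_lactE !phiE hom_lactE.
- by apply: ii; rewrite hom_ractE !phiE hom_ractE.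
by exists g => x; rewrite gE phiE.
Qed.

Lemma short_exactP K P X (i : bihom K P) (p : bihom P X) :
  short_exact i p <->
  [/\ (forall x, i x = 0 -> x = 0), (forall x, p (i x) = 0),
      (forall y, p y = 0 -> exists x, i x = y) & surjective p].
Proof.
split=> [[ii e ps]|[i0 pi ke ps]].
  split=> // [x x0|x|y y0].
  - by apply: ii; rewrite x0 linear0.
  - by apply/eqP; rewrite -memv_ker -e memv_img ?memvf.
  - have: y \in lker p by rewrite memv_ker y0.
    by rewrite -e => /memv_imgP [x _ ->]; exists x.
split=> // [x y xy|].
  by apply/eqP; rewrite -subr_eq0; apply/eqP/i0; rewrite linearB /= xy subrr.
apply/vspaceP => y; apply/memv_imgP/idP => [[x _ ->]|].
  by rewrite memv_ker pi.
by rewrite memv_ker => /eqP /ke [x <-]; exists x; rewrite ?memvf.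
Qed.

Lemma short_exact_inj0 K P X (i : bihom K P) (p : bihom P X) :
  short_exact i p -> forall x, i x = 0 -> x = 0.
Proof. by case/short_exactP. Qed.

Lemma short_exact_comp0 K P X (i : bihom K P) (p : bihom P X) :
  short_exact i p -> forall x, p (i x) = 0.
Proof. by case/short_exactP. Qed.

Lemma short_exact_ker K P X (i : bihom K P) (p : bihom P X) :
  short_exact i p -> forall y, p y = 0 -> exists x, i x = y.
Proof. by case/short_exactP. Qed.

Lemma short_exact_surj K P X (i : bihom K P) (p : bihom P X) :
  short_exact i p -> surjective p.
Proof. by case/short_exactP. Qed.

Lemma short_exact_inj K P X (i : bihom K P) (p : bihom P X) :
  short_exact i p -> injective i.
Proof. by case. Qed.

Lemma ker_short_exact P X (p : bihom P X) :
  surjective p -> short_exact (subincl (ker_stable p)) p.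
Proof.
move=> ps; apply/short_exactP; split=> // [x|x|y y0].
- by rewrite lfunE => x0; apply: subvs_inj; rewrite x0 linear0.
- by rewrite lfunE /=; apply/eqP; rewrite -memv_ker subvsP.
- have yK : y \in lker p by rewrite memv_ker y0.
  by exists (Subvs yK); rewrite lfunE.
Qed.

Lemma syz_short_exact X : short_exact (syz_incl X) (cover X).
Proof. exact: ker_short_exact (@cover_surj _ _ _ X). Qed.

Lemma lift_through_mono K P X Y (i : bihom K P) (p : bihom P X)
    (f : bihom Y P) :
  short_exact i p -> (forall y, p (f y) = 0) ->
  exists g : bihom Y K, forall y, i (g y) = f y.
Proof.
move=> e pf0; apply: factor_mono; first exact: short_exact_inj e.
by move=> y; apply: short_exact_ker e _ (pf0 y).
Qed.

Lemma factor_through_epi K P X Y (i : bihom K P) (p : bihom P X)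
    (f : bihom P Y) :
  short_exact i p -> (forall x, f (i x) = 0) ->
  exists g : bihom X Y, forall x, g (p x) = f x.
Proof.
move=> e fi0; apply: factor_epi; first exact: short_exact_surj e.
by move=> x /(short_exact_ker e) [u <-].
Qed.

End Homs.

(** * Vanishing of Ext, independently of resolutions *)

Section Ext.
(* Otherwise failed matches compare modules by unfolding them down to spaces
   of matrices. *)
#[local] Opaque free_on syz cover syz_incl subincl submod.
#[local] Opaque comphom addhom opphom idhom.
Variables (k : fieldType) (A B : falgType k).
Implicit Types (X Y Z P K E W : bimod A B).

(** Ext^1(X, Y) = 0, read off the functorial presentation of X. *)
Definition ext1_vanishes X Y : Prop :=
  forall f : bihom (syz X) Y,
  exists g : bihom (free_on X) Y, forall u, g (syz_incl X u) = f u.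

(** A lift H : P -> E of p along p' makes E the quotient of P + K' by a copy of
    K.  A homomorphism f on K' therefore extends to E as soon as its pullback to
    K extends to P: take the latter on P and f on K'.  As E is arbitrary, this
    gives both the independence of Ext^1 from the
    presentation and the extension property along arbitrary monomorphisms. *)
Lemma extension_transfer X Y K P K' E (i : bihom K P) (p : bihom P X)
    (i' : bihom K' E) (p' : bihom E X) :
  short_exact i p -> short_exact i' p' -> projective P ->
  (forall f : bihom K Y, exists g : bihom P Y, forall u, g (i u) = f u) ->
  forall f : bihom K' Y, exists g : bihom E Y, forall u, g (i' u) = f u.
Proof.
move=> e e' pP extP f.
have [H HE] := pP _ _ p' p (short_exact_surj e').
have [h hE] : exists h : bihom K K', forall u, i' (h u) = comphom H i u.
  apply: lift_through_mono e' _ => u.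
  by rewrite comphomE HE (short_exact_comp0 e).
have [g gE] := extP (comphom f h).
have [s sE] : exists s : 'Hom(E, P), forall y, p (s y) = p' y.
  exists ((hfun p)^-1 \o hfun p')%VF => y.
  by rewrite comp_lfunE (lfun_section (short_exact_surj e)).
pose r := ((hfun i')^-1 \o (\1 - (hfun H \o s)))%VF.
pose phi : 'Hom(E, Y) := ((hfun g \o s) + (hfun f \o r))%VF.
(* phi is computed by any z over p' y, not only by the k-linear choice s y; this
   is what makes it a homomorphism. *)
have rE z y : p z = p' y -> exists2 x, i' x = y - H z & phi y = g z + f x.
  move=> zy; have [|x xE] := short_exact_ker e' (y := y - H z).
    by rewrite linearB /= HE zy subrr.
  exists x => //; rewrite add_lfunE !comp_lfunE.
  have [|u uE] := short_exact_ker e (y := z - s y).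
    by rewrite linearB /= sE zy subrr.
  have riE : i' (((hfun i')^-1)%VF (y - H (s y))) = y - H (s y).
    rewrite limg_lfunVK //.
    have [|x' <-] := short_exact_ker e' (y := y - H (s y)).
      by rewrite linearB /= HE sE subrr.
    by rewrite memv_img ?memvf.
  rewrite add_lfunE opp_lfunE !comp_lfunE id_lfunE.
  set y' := ((hfun i')^-1)%VF _ in riE *.
  have y'E : y' = x + h u.
    apply: (short_exact_inj e'); rewrite riE linearD /= xE hE comphomE uE.
    by rewrite linearB addrA subrK.
  rewrite y'E linearD /= addrCA [RHS]addrC; congr (_ + _).
  have := gE u; rewrite comphomE => <-.
  by rewrite uE linearB /= addrC subrK.
have [||c y|F FE] := @bihom_of_fun _ _ _ E Y phi.
- exact: linearP.
- move=> a y; have [x xE ->] := rE _ _ (sE y).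
  have [|x' x'E ->] := rE (lact P a (s y)) (lact E a y).
    by rewrite !hom_lactE sE.
  have -> : x' = lact K' a x.
    by apply: (short_exact_inj e'); rewrite x'E !hom_lactE xE linearB.
  by rewrite !hom_lactE linearD.
- have [x xE ->] := rE _ _ (sE y).
  have [|x' x'E ->] := rE (ract P c (s y)) (ract E c y).
    by rewrite !hom_ractE sE.
  have -> : x' = ract K' c x.
    by apply: (short_exact_inj e'); rewrite x'E !hom_ractE xE linearB.
  by rewrite !hom_ractE linearD.
exists F => u; rewrite FE.
have [|x xE ->] := rE 0 (i' u); first by rewrite linear0 (short_exact_comp0 e').
rewrite linear0 add0r; congr (f _); apply: (short_exact_inj e').
by rewrite xE linear0 subr0.
Qed.

Lemma ext1_extend X Y K E (i : bihom K E) (p : bihom E X) :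
  short_exact i p -> ext1_vanishes X Y ->
  forall f : bihom K Y, exists g : bihom E Y, forall u, g (i u) = f u.
Proof.
move=> e; apply: extension_transfer (syz_short_exact X) e _.
exact: free_projective.
Qed.

Lemma ext1_of_presentation X Y K P (i : bihom K P) (p : bihom P X) :
  short_exact i p -> projective P ->
  (forall f : bihom K Y, exists g : bihom P Y, forall u, g (i u) = f u) ->
  ext1_vanishes X Y.
Proof. by move=> e; apply: extension_transfer e (syz_short_exact X). Qed.

Lemma projective_ext1 P Y : projective P -> ext1_vanishes P Y.
Proof.
move=> pP f; have [s sE] := pP _ _ (cover P) (idhom P) (@cover_surj _ _ _ P).
pose r := addhom (idhom (free_on P)) (opphom (comphom s (cover P))).
have [|t tE] := lift_through_mono (f := r) (syz_short_exact P).
  by move=> y; rewrite !bihomE linearB /= sE idhomE subrr.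
exists (comphom f t) => u; rewrite comphomE; congr (f _).
apply: (short_exact_inj (syz_short_exact P)).
rewrite tE !bihomE (short_exact_comp0 (syz_short_exact P)).
by rewrite linear0 subr0.
Qed.

(** The segment Ext^1(X, P) -> Ext^1(X, W) -> Ext^2(X, K) of the long exact
    sequence of K -> P -> W, with Ext^2(X, K) written as Ext^1 of the syzygy. *)
Lemma ext1_second X K P W (i : bihom K P) (p : bihom P W) :
  short_exact i p -> ext1_vanishes X P -> ext1_vanishes (syz X) K ->
  ext1_vanishes X W.
Proof.
move=> e extP extK f.
have [F FE] := @free_projective _ _ _ (syz X) _ _ p (comphom f (cover (syz X)))
  (short_exact_surj e).
have [|phi phiE] := lift_through_mono (f := comphom F (syz_incl (syz X))) e.
  move=> y; rewrite comphomE FE comphomE.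
  by rewrite (short_exact_comp0 (syz_short_exact _)) linear0.
have [phi' phi'E] := extK phi.
pose G := addhom F (opphom (comphom i phi')).
have [|F' F'E] := factor_through_epi (f := G) (syz_short_exact (syz X)).
  by move=> u; rewrite !bihomE phi'E phiE comphomE subrr.
have [g gE] := extP F'.
exists (comphom p g) => u; rewrite comphomE gE.
have [v <-] := short_exact_surj (syz_short_exact (syz X)) u.
rewrite F'E !bihomE linearB /= FE comphomE.
by rewrite (short_exact_comp0 e) subr0.
Qed.

(** Liftings are kept as a relation: kappa is determined by lambda only up to
    maps that factor through a projective module. *)
Definition lifts_to K P X K' P' X' (i : bihom K P) (p : bihom P X)
    (i' : bihom K' P') (p' : bihom P' X') (kappa : bihom K K')
    (lambda : bihom X X') : Prop :=
  exists pi : bihom P P', (forall u, pi (i u) = i' (kappa u)) /\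
                          (forall z, p' (pi z) = lambda (p z)).

Lemma lifts_to_exists K P X K' P' X' (i : bihom K P) (p : bihom P X)
    (i' : bihom K' P') (p' : bihom P' X') (lambda : bihom X X') :
  short_exact i p -> short_exact i' p' -> projective P ->
  exists kappa : bihom K K', lifts_to i p i' p' kappa lambda.
Proof.
move=> e e' pP.
have [H HE] := pP _ _ p' (comphom lambda p) (short_exact_surj e').
have [|h hE] := lift_through_mono (f := comphom H i) e'.
  by move=> u; rewrite comphomE HE comphomE (short_exact_comp0 e) linear0.
exists h, H; split=> [u|z]; first by rewrite hE comphomE.
by rewrite HE comphomE.
Qed.

(** Two lifts P -> P' of lambda differ by a map into K', so the two maps on
    kernels differ by a map that factors through P. *)
Lemma lifts_to_unique K P X K' P' X' (i : bihom K P) (p : bihom P X)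
    (i' : bihom K' P') (p' : bihom P' X')
    (kappa1 kappa2 : bihom K K') (lambda : bihom X X') :
  short_exact i' p' -> projective P ->
  lifts_to i p i' p' kappa1 lambda -> lifts_to i p i' p' kappa2 lambda ->
  stable_eq kappa1 kappa2.
Proof.
move=> e' pP [pi1 [k1 l1]] [pi2 [k2 l2]].
have [|t tE] := lift_through_mono (f := addhom pi1 (opphom pi2)) e'.
  by move=> z; rewrite !bihomE linearB /= l1 l2 subrr.
exists P, i, t; split=> //; apply/lfunP => u.
apply: (short_exact_inj e').
rewrite comp_lfunE tE !bihomE k1 k2 add_lfunE opp_lfunE.
by rewrite linearB.
Qed.

Lemma lifts_to_comp K P X K' P' X' K'' P'' X'' (i : bihom K P)
    (p : bihom P X) (i' : bihom K' P') (p' : bihom P' X')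
    (i'' : bihom K'' P'') (p'' : bihom P'' X'') (kappa : bihom K K')
    (lambda : bihom X X') (kappa' : bihom K' K'') (lambda' : bihom X' X'') :
  lifts_to i' p' i'' p'' kappa' lambda' -> lifts_to i p i' p' kappa lambda ->
  lifts_to i p i'' p'' (comphom kappa' kappa) (comphom lambda' lambda).
Proof.
move=> [pi' [k' l']] [pi [k0 l]]; exists (comphom pi' pi).
by split=> u; rewrite !comphomE ?k0 ?k' ?l' ?l.
Qed.

Lemma lifts_to_id K P X (i : bihom K P) (p : bihom P X) :
  lifts_to i p i p (idhom K) (idhom X).
Proof. by exists (idhom P); split=> u; rewrite !idhomE. Qed.

Lemma lifts_to_ext K P X K' P' X' (i : bihom K P) (p : bihom P X)
    (i' : bihom K' P') (p' : bihom P' X') (kappa : bihom K K')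
    (lambda lambda' : bihom X X') :
  (forall x, lambda x = lambda' x) ->
  lifts_to i p i' p' kappa lambda -> lifts_to i p i' p' kappa lambda'.
Proof. by move=> ll [pi [k0 l]]; exists pi; split=> // z; rewrite l ll. Qed.

Lemma syz_map_lifts X Y (f : bihom X Y) :
  lifts_to (syz_incl X) (cover X) (syz_incl Y) (cover Y) (syz_map f) f.
Proof.
exists (free_map f); split=> u; last exact: cover_nat.
by rewrite !syz_inclE syz_mapE.
Qed.

Lemma lifts_to_iso K P X K' P' (i : bihom K P) (p : bihom P X)
    (i' : bihom K' P') (p' : bihom P' X) (kappa : bihom K K') :
  short_exact i p -> short_exact i' p' -> projective P -> projective P' ->
  lifts_to i p i' p' kappa (idhom X) -> @is_iso (stab A B) K K' kappa.
Proof.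
move=> e e' pP pP' lk.
have [kappa' lk'] := lifts_to_exists (idhom X) e' e pP'.
exists kappa'; split.
  apply: (lifts_to_unique (lambda := idhom X)) e pP _ (lifts_to_id _ _).
  by apply: (lifts_to_ext _ (lifts_to_comp lk' lk)) => x; rewrite comphomE !idhomE.
apply: (lifts_to_unique (lambda := idhom X)) e' pP' _ (lifts_to_id _ _).
by apply: (lifts_to_ext _ (lifts_to_comp lk lk')) => x; rewrite comphomE !idhomE.
Qed.

(** Enough for Ext, and closed under syzygies; unlike direct summands up to
    projectives it needs no direct sums. *)
Definition stable_retract X X' : Prop :=
  exists (f : bihom X X') (g : bihom X' X), stable_eq (comphom g f) (idhom X).

Lemma stable_retract_iso X X' (f : bihom X X') :
  @is_iso (stab A B) X X' f -> stable_retract X X'.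
Proof. by move=> [g [gf _]]; exists f, g. Qed.

Lemma syzygy_stable_retract K P X K' P' (i : bihom K P) (p : bihom P X)
    (i' : bihom K' P') (p' : bihom P' X) :
  short_exact i p -> short_exact i' p' -> projective P -> projective P' ->
  stable_retract K K'.
Proof.
move=> e e' pP pP'; have [kappa lk] := lifts_to_exists (idhom X) e e' pP.
exact: stable_retract_iso (lifts_to_iso e e' pP pP' lk).
Qed.

Lemma stable_retract_syz X X' :
  stable_retract X X' -> stable_retract (syz X) (syz X').
Proof.
move=> [f [g gf]]; exists (syz_map f), (syz_map g).
apply: (@heq_trans (stab A B) _ _ _ (syz_map (comphom g f))).
  exact: (@heq_sym (stab A B) _ _ _ _ (@fmapM _ _ (syz_functor A B) _ _ _ g f)).
apply: (@heq_trans (stab A B) _ _ _ (syz_map (idhom X))).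
  exact: (@fmap_heq _ _ (syz_functor A B) _ _ _ _ gf).
exact: (@fmap1 _ _ (syz_functor A B) X).
Qed.

Lemma stable_retract_iter_syz j X X' :
  stable_retract X X' ->
  stable_retract (iter j (@syz k A B) X) (iter j (@syz k A B) X').
Proof. by elim: j => //= j IH r; apply/stable_retract_syz/IH. Qed.

(** Modulo the homomorphism induced through the syzygy of a projective module P,
    phi factors through the syzygy of X'; both parts extend. *)
Lemma ext1_stable_retract X X' Y :
  stable_retract X X' -> ext1_vanishes X' Y -> ext1_vanishes X Y.
Proof.
move=> [f [g [P [u [v [pP e]]]]]] extX' phi.
have [psi psiE] := extX' (comphom phi (syz_map g)).
have [chi chiE] := projective_ext1 pP (comphom phi (syz_map v)).
exists (addhom (comphom psi (free_map f)) (opphom (comphom chi (free_map u)))).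
move=> w; rewrite !bihomE.
have mapE Z (h : bihom X Z) : free_map h (syz_incl X w) = syz_incl Z (syz_map h w).
  by rewrite !syz_inclE syz_mapE.
rewrite !mapE psiE chiE !comphomE -linearB /=; congr (phi _).
apply: syz_ext; rewrite [_ - _]addrC -scaleN1r syz_valP scaleN1r addrC !syz_mapE.
rewrite -!free_map_comp.
have := @free_mapB _ _ _ _ _ (comphom g f) (idhom X) (comphom v u) e (syz_val w).
by rewrite free_map1 => <-; rewrite opprB addrCA subrr addr0.
Qed.

(** Ext^j(X, Y) = 0 for all j > 0, by dimension shift. *)
Definition all_ext X Y : Prop :=
  forall j, ext1_vanishes (iter j (@syz k A B) X) Y.

Lemma all_ext_stable_retract X X' Y :
  stable_retract X X' -> all_ext X' Y -> all_ext X Y.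
Proof.
move=> r h j; apply: ext1_stable_retract (h j).
exact: stable_retract_iter_syz.
Qed.

Lemma all_ext_syz X Y : all_ext X Y -> all_ext (syz X) Y.
Proof. by move=> h j; rewrite -iterSr; apply: h. Qed.

Lemma all_extS X Y :
  ext1_vanishes X Y -> all_ext (syz X) Y -> all_ext X Y.
Proof. by move=> e h [|j] //; rewrite iterSr; apply: h. Qed.

Lemma all_ext_kernel K P X Y (i : bihom K P) (p : bihom P X) :
  short_exact i p -> projective P -> all_ext X Y -> all_ext K Y.
Proof.
move=> e pP /all_ext_syz; apply: all_ext_stable_retract.
exact: syzygy_stable_retract e (syz_short_exact X) pP (@free_projective _ _ _ X).
Qed.

Lemma all_ext_cokernel K P X Y (i : bihom K P) (p : bihom P X) :
  short_exact i p -> projective P ->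
  (forall f : bihom K Y, exists g : bihom P Y, forall u, g (i u) = f u) ->
  all_ext K Y -> all_ext X Y.
Proof.
move=> e pP ext h; apply: all_extS; first exact: ext1_of_presentation e pP ext.
apply: all_ext_stable_retract h.
exact: syzygy_stable_retract (syz_short_exact X) e (@free_projective _ _ _ X) pP.
Qed.

(** Vanishing of all Ext^j(X, -) is used to climb projective resolutions of
    the second argument. *)
Lemma all_ext_second X K P W (i : bihom K P) (p : bihom P W) :
  short_exact i p -> all_ext X P -> all_ext X K -> all_ext X W.
Proof. by move=> e hP hK j; apply: ext1_second e (hP j) (hK j.+1). Qed.

(** The resolution by functorial free covers has the iterated syzygies as its
    modules of cycles. *)
Lemma Ext_vanishes_all_ext X Y :
  (forall j, (0 < j)%N -> Ext_vanishes j X Y) -> all_ext X Y.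
Proof.
move=> h j f.
have [|g gE] := h j.+1 isT (free_res X) (comphom f (cover _)) _.
  apply/lfunP => x; rewrite zero_lfunE comp_lfunE comphomE /=.
  by rewrite comp_lfunE (short_exact_comp0 (syz_short_exact _)) linear0.
exists g => u; have [x <-] := @cover_surj _ _ _ _ u.
by have /lfunP/(_ x) := gE; rewrite /= !comp_lfunE.
Qed.

Section Truncation.
Variables (X : bimod A B) (R : projres X).

Let K := submod (ker_stable (pr_aug R)).

Lemma res_cycle_cover : exists c : bihom (pr_ob R 1) K,
  forall x, subincl (ker_stable (pr_aug R)) (c x) = pr_diff R 0 x.
Proof.
apply: lift_through_mono (ker_short_exact (@pr_aug_surj _ _ _ _ R)) _ => y.
by apply/eqP; rewrite -memv_ker -pr_exact0 memv_img ?memvf.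
Qed.

(** Dropping the first term shifts the degree by one, and leaves the cocycle
    and coboundary conditions literally unchanged. *)
Lemma truncation_exists : exists R' : projres K,
  forall j Y, (forall f : bihom (pr_ob R' j.+1) Y, cocycle f -> coboundary f) ->
   forall f : bihom (pr_ob R j.+2) Y, cocycle f -> coboundary f.
Proof.
have [c cE] := res_cycle_cover.
have e := ker_short_exact (@pr_aug_surj _ _ _ _ R).
have c0 y : c y = 0 <-> pr_diff R 0 y = 0.
  rewrite -cE; split=> [->|y0]; first by rewrite linear0.
  exact: short_exact_inj0 e _ y0.
unshelve eexists.
  apply: (@Projres _ _ _ K (fun j => pr_ob R j.+1) (fun j => pr_diff R j.+1) c).
  - by move=> j; apply: pr_proj.
  - move=> z; have : subincl (ker_stable (pr_aug R)) z \in limg (pr_diff R 0).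
      by rewrite pr_exact0 memv_ker (short_exact_comp0 e).
    move=> /memv_imgP [y _ yE]; exists y; apply: (short_exact_inj e).
    by rewrite cE yE.
  - rewrite pr_exact; apply/vspaceP => y; rewrite !memv_ker.
    by apply/eqP/eqP => /c0.
  - by move=> j; rewrite pr_exact.
by move=> j Y h f /h.
Qed.

Lemma Ext1_of_ext1 Y : ext1_vanishes X Y ->
  forall f : bihom (pr_ob R 1) Y, cocycle f -> coboundary f.
Proof.
move=> ext f f0; have [c cE] := res_cycle_cover.
have e := ker_short_exact (@pr_aug_surj _ _ _ _ R).
have cs : surjective c.
  move=> z; have : subincl (ker_stable (pr_aug R)) z \in limg (pr_diff R 0).
    by rewrite pr_exact0 memv_ker (short_exact_comp0 e).
  move=> /memv_imgP [y _ yE]; exists y; apply: (short_exact_inj e).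
  by rewrite cE yE.
have [x x0|g gE] := factor_epi (f := f) cs.
  have : x \in limg (pr_diff R 1) by rewrite pr_exact memv_ker -cE x0 linear0.
  move=> /memv_imgP [y _ ->]; rewrite -comp_lfunE.
  by have /lfunP/(_ y) := f0; rewrite zero_lfunE.
have [G GE] := ext1_extend e ext g.
by exists G; apply/lfunP => x; rewrite comp_lfunE -cE GE gE.
Qed.

End Truncation.

Lemma all_ext_Ext_vanishes X Y :
  all_ext X Y -> forall j, (0 < j)%N -> Ext_vanishes j X Y.
Proof.
move=> h [//|j] _ R; elim: j => [|j IH] in X R h *.
  exact: Ext1_of_ext1 (h 0).
have [R' R'E] := truncation_exists R; apply: R'E; apply: IH.
have e := ker_short_exact (@pr_aug_surj _ _ _ _ R).
exact: (all_ext_kernel e (@pr_proj _ _ _ _ R 0) h).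
Qed.

End Ext.

(** * Dual bases of projective modules *)

Section Zero.
Variables (k : fieldType) (A B : falgType k) (X : bimod A B).

Lemma lact0E x : lact X 0 x = 0.
Proof.
by have := lactPE (-1) 0 0 x; rewrite scaler0 addr0 scaleN1r addNr.
Qed.

Lemma ract0E x : ract X 0 x = 0.
Proof.
by have := ractPE (-1) 0 0 x; rewrite scaler0 addr0 scaleN1r addNr.
Qed.

End Zero.

Section OneSided.
Variables (k : fieldType) (A : falgType k).

Lemma lmod_ractE (X : lmod A) c x : ract X c x = c *: x.
Proof.
have := ractPE (k := k) (c : k) (1 : k^o) 0 x.
by rewrite ract0E !addr0 ract1E -[(c : k) *: _]/(c * 1) mulr1.
Qed.

Lemma rmod_lactE (X : bimod k^o A) c x : lact X c x = c *: x.
Proof.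
have := lactPE (k := k) (c : k) (1 : k^o) 0 x.
by rewrite lact0E !addr0 lact1E -[(c : k) *: _]/(c * 1) mulr1.
Qed.

Lemma lmod_hom_of_fun (X Y : lmod A) (phi : X -> Y) : linear phi ->
  (forall a x, phi (lact X a x) = lact Y a (phi x)) ->
  exists f : bihom X Y, forall x, f x = phi x.
Proof.
move=> L l; apply: bihom_of_fun => // c x.
rewrite !lmod_ractE; have := L c x 0; rewrite !addr0 => ->.
have := L (-1) 0 0; rewrite scaler0 addr0 scaleN1r addNr => ->.
by rewrite addr0.
Qed.

Lemma rmod_hom_of_fun (X Y : bimod k^o A) (phi : X -> Y) : linear phi ->
  (forall a x, phi (ract X a x) = ract Y a (phi x)) ->
  exists f : bihom X Y, forall x, f x = phi x.
Proof.
move=> L l; apply: bihom_of_fun => // c x.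
rewrite !rmod_lactE; have := L c x 0; rewrite !addr0 => ->.
have := L (-1) 0 0; rewrite scaler0 addr0 scaleN1r addNr => ->.
by rewrite addr0.
Qed.

Notation lreg := (lres (reg A)).
Notation rreg := (rres (reg A)).

Lemma reg_lactE (a b : A) : lact (reg A) a b = a * b.
Proof. by rewrite /= lfunE. Qed.
Lemma reg_ractE (a b : A) : ract (reg A) a b = b * a.
Proof. by rewrite /= lfunE. Qed.
Lemma lreg_lactE (a b : A) : lact lreg a b = a * b.
Proof. by rewrite /= lfunE. Qed.
Lemma rreg_ractE (a b : A) : ract rreg a b = b * a.
Proof. by rewrite /= lfunE. Qed.

(** Dual bases turn projectivity into finite sums, which are compatible with
    dualising and with tensor products. *)
Definition left_dual_basis (P : lmod A) m (e : 'I_m -> P)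
    (f : 'I_m -> bihom P lreg) : Prop :=
  forall x, x = \sum_j lact P (f j x) (e j).

Definition right_dual_basis (P : bimod k^o A) m (e : 'I_m -> P)
    (f : 'I_m -> bihom P rreg) : Prop :=
  forall x, x = \sum_j ract P (f j x) (e j).

Lemma coord1_linear (X : vectType k) j :
  linear (fun x : X => v2r x 0 j *: (1 : A)).
Proof. by move=> c x y; rewrite linearP !mxE scalerDl scalerA. Qed.

(** A k-basis of P gives an A-basis of the free cover, of which P is a retract. *)
Lemma left_dual_basis_exists (P : lmod A) : projective P ->
  exists m (e : 'I_m -> P) (f : 'I_m -> bihom P lreg), left_dual_basis e f.
Proof.
move=> pP; have [s sE] := pP _ _ (cover P) (idhom P) (@cover_surj _ _ _ P).
pose e j : P := r2v (delta_mx 0 j).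
pose g j : bihom (free_on P) lreg :=
  @free_lift _ _ _ P lreg (mklfun (@coord1_linear P j)).
have L j : linear (fun z => lact P (g j z) (e j)).
  by move=> c y z; rewrite linearP lactPE.
have gE : hfun (cover P) = \sum_j mklfun (L j).
  apply: free_ext => a x c; rewrite coverE sum_lfunE lmod_ractE.
  rewrite {1}[x]v2r_sum linear_sum scaler_sumr; apply: eq_bigr => j _.
  rewrite mklfunE /g free_liftE mklfunE lmod_ractE lreg_lactE.
  rewrite -scalerAr mulr1 scalerA linearZ /= scalerA.
  have := @lactPE _ _ _ P (c * v2r x 0 j) a 0 (e j).
  by rewrite lact0E !addr0.
exists _, e, (fun j => comphom (g j) s) => x.
rewrite -{1}[x]idhomE -sE gE sum_lfunE; apply: eq_bigr => j _.
by rewrite mklfunE comphomE.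
Qed.

Lemma right_dual_basis_exists (P : bimod k^o A) : projective P ->
  exists m (e : 'I_m -> P) (f : 'I_m -> bihom P rreg), right_dual_basis e f.
Proof.
move=> pP; have [s sE] := pP _ _ (cover P) (idhom P) (@cover_surj _ _ _ P).
pose e j : P := r2v (delta_mx 0 j).
pose g j : bihom (free_on P) rreg :=
  @free_lift _ _ _ P rreg (mklfun (@coord1_linear P j)).
have L j : linear (fun z => ract P (g j z) (e j)).
  by move=> c y z; rewrite linearP ractPE.
have gE : hfun (cover P) = \sum_j mklfun (L j).
  apply: free_ext => c x a; rewrite coverE sum_lfunE rmod_lactE.
  rewrite {1}[x]v2r_sum linearZ /= linear_sum scaler_sumr; apply: eq_bigr => j _.
  have gE' : g j (free_pure c x a) =
      ract rreg a (lact rreg c (mklfun (@coord1_linear P j) x)).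
    exact: free_liftE.
  rewrite mklfunE gE' mklfunE rmod_lactE rreg_ractE.
  rewrite scalerA -scalerAl mul1r linearZ /= scalerA.
  have := @ractPE _ _ _ P (c * v2r x 0 j) a 0 (e j).
  by rewrite ract0E !addr0.
exists _, e, (fun j => comphom (g j) s) => x.
rewrite -{1}[x]idhomE -sE gE sum_lfunE; apply: eq_bigr => j _.
by rewrite mklfunE comphomE.
Qed.

Lemma left_dual_basis_projective (P : lmod A) m (e : 'I_m -> P)
    (f : 'I_m -> bihom P lreg) : left_dual_basis e f -> projective P.
Proof.
move=> ef Y Z g h gs; pose y j : Y := ((hfun g)^-1)%VF (h (e j)).
have [||H HE] := @lmod_hom_of_fun P Y (fun x => \sum_j lact Y (f j x) (y j)).
- move=> c u v; rewrite scaler_sumr -big_split; apply: eq_bigr => j _.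
  by rewrite linearP lactPE.
- move=> a x; rewrite linear_sum; apply: eq_bigr => j _.
  by rewrite hom_lactE lreg_lactE lactME.
exists H => x; rewrite HE [in RHS](ef x) !linear_sum; apply: eq_bigr => j _.
by rewrite /= !hom_lactE (lfun_section gs).
Qed.

Lemma right_dual_basis_projective (P : bimod k^o A) m (e : 'I_m -> P)
    (f : 'I_m -> bihom P rreg) : right_dual_basis e f -> projective P.
Proof.
move=> ef Y Z g h gs; pose y j : Y := ((hfun g)^-1)%VF (h (e j)).
have [||H HE] := @rmod_hom_of_fun P Y (fun x => \sum_j ract Y (f j x) (y j)).
- move=> c u v; rewrite scaler_sumr -big_split; apply: eq_bigr => j _.
  by rewrite linearP ractPE.
- move=> a x; rewrite linear_sum; apply: eq_bigr => j _.
  by rewrite hom_ractE rreg_ractE ractME.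
exists H => x; rewrite HE [in RHS](ef x) !linear_sum; apply: eq_bigr => j _.
by rewrite /= !hom_ractE (lfun_section gs).
Qed.

End OneSided.

Notation lreg A := (lres (reg A)).
Notation rreg A := (rres (reg A)).

(** * Duals and pairings *)

Section Duals.
Variables (k : fieldType) (A : falgType k).
Implicit Types (X P Z : lmod A) (K F W : bimod k^o A).

Definition rdual K : lmod A := rhom K (reg A).
Definition rdual_val K (u : rdual K) : 'Hom(K, A) := rhom_val u.

Lemma ldual0 X x : lhom_val (0 : ldual X) x = 0.
Proof. by rewrite /lhom_val linear0 zero_lfunE. Qed.

Lemma rdual0 K y : rdual_val (0 : rdual K) y = 0.
Proof. by rewrite /rdual_val /rhom_val linear0 zero_lfunE. Qed.

Lemma ldual_lact X (u : ldual X) a x : lhom_val u (lact X a x) = a * lhom_val u x.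
Proof. by rewrite lhom_hom reg_lactE. Qed.

Lemma ldual_ract X (u : ldual X) a x :
  lhom_val (ract (ldual X) a u) x = lhom_val u x * a.
Proof. by rewrite lhom_ractE comp_lfunE reg_ractE. Qed.

Lemma ldual_hom X (u : ldual X) :
  exists f : bihom X (lreg A), forall x, f x = lhom_val u x.
Proof.
apply: lmod_hom_of_fun => [|a x]; first exact: linearP.
by rewrite ldual_lact lreg_lactE.
Qed.

Lemma ldual_of_hom X (f : bihom X (lreg A)) :
  exists u : ldual X, forall x, lhom_val u x = f x.
Proof.
have [|u uE] := @lhom_mk _ _ _ _ X (reg A) (hfun f).
  by move=> a x; apply: (hom_lactE f a x).
by exists u => x; rewrite uE.
Qed.

Lemma rdual_ext K (u v : rdual K) :
  (forall y, rdual_val u y = rdual_val v y) -> u = v.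
Proof. by move=> uv; apply: subvs_inj; apply/lfunP. Qed.

Lemma rdual_valP K c (u v : rdual K) y :
  rdual_val (c *: u + v) y = c *: rdual_val u y + rdual_val v y.
Proof. by rewrite /rdual_val /rhom_val linearP add_lfunE scale_lfunE. Qed.

Lemma rdual_ract K (u : rdual K) a y :
  rdual_val u (ract K a y) = rdual_val u y * a.
Proof.
have /rhom_spaceP/(_ a)/lfunP/(_ y) := subvsP u.
by rewrite !comp_lfunE reg_ractE.
Qed.

Lemma rdual_lact K (u : rdual K) a y :
  rdual_val (lact (rdual K) a u) y = a * rdual_val u y.
Proof. by rewrite /rdual_val rhom_lactE comp_lfunE reg_lactE. Qed.

Lemma rdual_hom K (u : rdual K) :
  exists f : bihom K (rreg A), forall y, f y = rdual_val u y.
Proof.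
apply: rmod_hom_of_fun => [|a x]; first exact: linearP.
by rewrite rdual_ract rreg_ractE.
Qed.

Lemma rdual_of_hom K (f : bihom K (rreg A)) :
  exists u : rdual K, forall y, rdual_val u y = f y.
Proof.
have fS : hfun f \in rhom_space K (reg A).
  apply/rhom_spaceP => a; apply/lfunP => x; rewrite !comp_lfunE.
  exact: (hom_ractE f a x).
exists (vsproj (rhom_space K (reg A)) (hfun f)) => y.
by rewrite /rdual_val /rhom_val vsprojK.
Qed.

(** A left and a right module paired into A.  Reflexivity of Z and duality of Z
    and K become the symmetric condition that the pairing is perfect on both
    sides, so that no identification of Z with its bidual has to be carried
    along. *)
Record pairing Z K := Pairing {
  pval :> Z -> K -> A;
  pval_linl : forall y, linear (pval^~ y);
  pval_linr : forall z, linear (pval z);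
  pval_lact : forall a z y, pval (lact Z a z) y = a * pval z y;
  pval_ract : forall a z y, pval z (ract K a y) = pval z y * a
}.

Definition eval_pairing X : pairing X (ldual X).
Proof.
refine (@Pairing X (ldual X) (fun x u => lhom_val u x) _ _ _ _).
- by move=> u c x y; rewrite linearP.
- by move=> x c u v; rewrite lhom_valP.
- by move=> a x u; rewrite ldual_lact.
- by move=> a x u; rewrite ldual_ract.
Defined.

Definition reval_pairing K : pairing (rdual K) K.
Proof.
refine (@Pairing (rdual K) K (fun u y => rdual_val u y) _ _ _ _).
- by move=> y c u v; rewrite rdual_valP.
- by move=> u c x y; rewrite linearP.
- by move=> a u y; rewrite rdual_lact.
- by move=> a u y; rewrite rdual_ract.
Defined.

Definition right_perfect Z K (b : pairing Z K) : Prop :=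
  (forall f : bihom Z (lreg A), exists y, forall z, f z = b z y) /\
  (forall y, (forall z, b z y = 0) -> y = 0).

Definition left_perfect Z K (b : pairing Z K) : Prop :=
  (forall f : bihom K (rreg A), exists z, forall y, f y = b z y) /\
  (forall z, (forall y, b z y = 0) -> z = 0).

Lemma pairing_lhom Z K (b : pairing Z K) y :
  exists f : bihom Z (lreg A), forall z, f z = b z y.
Proof.
apply: lmod_hom_of_fun => [|a z]; first exact: pval_linl.
by rewrite pval_lact lreg_lactE.
Qed.

Lemma pairing_rhom Z K (b : pairing Z K) z :
  exists f : bihom K (rreg A), forall y, f y = b z y.
Proof.
apply: rmod_hom_of_fun => [|a y]; first exact: pval_linr.
by rewrite pval_ract rreg_ractE.
Qed.

Lemma eval_right_perfect X : right_perfect (eval_pairing X).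
Proof.
split=> [f|u u0]; first by have [u uE] := ldual_of_hom f; exists u => x /=.
by apply: lhom_ext => x; rewrite [LHS]u0 ldual0.
Qed.

Lemma reval_left_perfect K : left_perfect (reval_pairing K).
Proof.
split=> [f|u u0]; first by have [u uE] := rdual_of_hom f; exists u => x /=.
by apply: rdual_ext => x; rewrite [LHS]u0 rdual0.
Qed.

Lemma ldual_map X Y (f : bihom X Y) : exists g : bihom (ldual Y) (ldual X),
  forall u x, lhom_val (g u) x = lhom_val u (f x).
Proof.
have [|a u m|b u m|c u m|g gE] :=
  @curry _ _ _ _ X (ldual Y) (reg A) (fun u x => lhom_val u (f x)).
- by split=> [x|u] c u1 u2; rewrite ?lhom_valP // !linearP.
- by rewrite hom_lactE lhom_hom.
- by rewrite lhom_lactE comp_lfunE hom_ractE.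
- by rewrite lhom_ractE comp_lfunE.
by exists g.
Qed.

Lemma rdual_map K W (f : bihom K W) : exists g : bihom (rdual W) (rdual K),
  forall u y, rdual_val (g u) y = rdual_val u (f y).
Proof.
have H (u : rdual W) : exists v : rdual K,
    forall y, rdual_val v y = rdual_val u (f y).
  have [h hE] := rdual_hom u; have [v vE] := rdual_of_hom (comphom h f).
  by exists v => y; rewrite vE comphomE hE.
have [g gE] := functional_choice _ H.
have [||G GE] := @lmod_hom_of_fun _ _ (rdual W) (rdual K) g.
- by move=> c u v; apply: rdual_ext => y; rewrite !(gE, rdual_valP).
- by move=> a u; apply: rdual_ext => y; rewrite !(gE, rdual_lact).
by exists G => u y; rewrite GE gE.
Qed.

End Duals.

Section DualBases.
Variables (k : fieldType) (A : falgType k) (Z : lmod A) (K : bimod k^o A).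
Variable b : pairing Z K.

Lemma pairing_suml y (I : finType) (a : I -> A) (z : I -> Z) :
  b (\sum_i lact Z (a i) (z i)) y = \sum_i a i * b (z i) y.
Proof.
have [f fE] := pairing_lhom b y; rewrite -fE linear_sum.
by apply: eq_bigr => i _ /=; rewrite fE pval_lact.
Qed.

Lemma pairing_sumr z (I : finType) (a : I -> A) (y : I -> K) :
  b z (\sum_i ract K (a i) (y i)) = \sum_i b z (y i) * a i.
Proof.
have [f fE] := pairing_rhom b z; rewrite -fE linear_sum.
by apply: eq_bigr => i _ /=; rewrite fE pval_ract.
Qed.

(** Bases dual to each other under the pairing: then both modules are projective
    and each is the dual of the other. *)
Definition dual_bases m (p : 'I_m -> Z) (q : 'I_m -> K) : Prop :=
  (forall z, z = \sum_j lact Z (b z (q j)) (p j)) /\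
  (forall y, y = \sum_j ract K (b (p j) y) (q j)).

Variables (m : nat) (p : 'I_m -> Z) (q : 'I_m -> K).
Hypothesis pq : dual_bases p q.

Lemma dual_bases_left_perfect : left_perfect b.
Proof.
split=> [f|z z0]; last first.
  by rewrite (pq.1 z); apply: big1 => j _; rewrite z0 lact0E.
exists (\sum_j lact Z (f (q j)) (p j)) => y.
rewrite pairing_suml {1}(pq.2 y) linear_sum; apply: eq_bigr => j _ /=.
by rewrite (hom_ractE f) rreg_ractE.
Qed.

Lemma dual_bases_right_perfect : right_perfect b.
Proof.
split=> [f|y y0]; last first.
  by rewrite (pq.2 y); apply: big1 => j _; rewrite y0 ract0E.
exists (\sum_j ract K (f (p j)) (q j)) => z.
rewrite pairing_sumr {1}(pq.1 z) linear_sum; apply: eq_bigr => j _ /=.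
by rewrite (hom_lactE f) lreg_lactE.
Qed.

Lemma dual_bases_left_projective : projective Z.
Proof.
have [f fE] := functional_choice _ (fun j => pairing_lhom b (q j)).
apply: (@left_dual_basis_projective _ _ Z m p f) => z.
by rewrite {1}(pq.1 z); apply: eq_bigr => j _; rewrite fE.
Qed.

Lemma dual_bases_right_projective : projective K.
Proof.
have [f fE] := functional_choice _ (fun j => pairing_rhom b (p j)).
apply: (@right_dual_basis_projective _ _ K m q f) => y.
by rewrite {1}(pq.2 y); apply: eq_bigr => j _; rewrite fE.
Qed.

End DualBases.

Section ProjectiveDuals.
Variables (k : fieldType) (A : falgType k).

Lemma eval_dual_bases (P : lmod A) : projective P ->
  exists m (p : 'I_m -> P) (q : 'I_m -> ldual P),
    dual_bases (eval_pairing P) p q.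
Proof.
move=> /left_dual_basis_exists [m [p [f pf]]].
have [q qE] := functional_choice _ (fun j => ldual_of_hom (f j)).
exists m, p, q; split=> [z|u].
  by rewrite {1}(pf z); apply: eq_bigr => j _; rewrite -qE.
apply: lhom_ext => x; rewrite -[RHS]/(eval_pairing P x _) pairing_sumr.
rewrite {1}(pf x) linear_sum; apply: eq_bigr => j _ /=.
by rewrite ldual_lact qE.
Qed.

Lemma reval_dual_bases (F : bimod k^o A) : projective F ->
  exists m (p : 'I_m -> rdual F) (q : 'I_m -> F),
    dual_bases (reval_pairing F) p q.
Proof.
move=> /right_dual_basis_exists [m [q [f qf]]].
have [p pE] := functional_choice _ (fun j => rdual_of_hom (f j)).
exists m, p, q; split=> [u|y]; last first.
  by rewrite {1}(qf y); apply: eq_bigr => j _; rewrite -pE.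
apply: rdual_ext => x; rewrite -[RHS]/(reval_pairing F _ x) pairing_suml.
rewrite {1}(qf x) linear_sum; apply: eq_bigr => j _ /=.
by rewrite rdual_ract pE.
Qed.

End ProjectiveDuals.

(** * Gorenstein dimension zero by coresolutions *)

Section Gorenstein.
#[local] Opaque free_on syz cover syz_incl subincl comphom addhom opphom idhom.
#[local] Opaque submod lhom rhom ldual rdual lhom_val rdual_val biduality.
Variables (k : fieldType) (A : falgType k).
Implicit Types (X P Z : lmod A) (K F W : bimod k^o A).

(** Classes of modules without Ext into A whose members embed into projective
    modules with cokernel in the class.  Members have totally acyclic
    complexes of projectives around them. *)
Definition coresolving (C : lmod A -> Prop) : Prop :=
  forall X, C X -> all_ext X (lreg A) /\
    exists X' P (i : bihom X P) (p : bihom P X'),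
      [/\ short_exact i p, projective P & C X'].

Definition gproj X : Prop := exists2 C, coresolving C & C X.

Lemma gproj_coresolving : coresolving gproj.
Proof.
move=> X [C hC CX]; have [h [X' [P [i [p [e pP CX']]]]]] := hC X CX.
by split=> //; exists X', P, i, p; split=> //; exists C.
Qed.

Lemma gproj_all_ext X : gproj X -> all_ext X (lreg A).
Proof. by move=> /gproj_coresolving []. Qed.

Lemma gproj_ext1 X : gproj X -> ext1_vanishes X (lreg A).
Proof. by move=> gX; apply: (gproj_all_ext gX (j := 0)). Qed.

Lemma gproj_coresolution X : gproj X ->
  exists X' P (i : bihom X P) (p : bihom P X'),
    [/\ short_exact i p, projective P & gproj X'].
Proof. by move=> /gproj_coresolving []. Qed.

(** The syzygy of X embeds into a free module with cokernel X. *)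
Lemma gproj_syz X : gproj X -> gproj (syz X).
Proof.
move=> gX; exists (fun Z => gproj Z \/ exists2 X, gproj X & Z = syz X); last first.
  by right; exists X.
move=> Z [gZ|[{gX}X gX ->]].
  have [h [X' [P [i [p [e pP gX']]]]]] := gproj_coresolving gZ.
  by split=> //; exists X', P, i, p; split=> //; left.
split; first exact/all_ext_syz/gproj_all_ext.
exists X, (free_on X), (syz_incl X), (cover X); split; last by left.
  exact: syz_short_exact.
exact: free_projective.
Qed.

(** Extend the coordinates of a homomorphism into P with respect to a dual
    basis. *)
Lemma ext1_projective X P :
  ext1_vanishes X (lreg A) -> projective P -> ext1_vanishes X P.
Proof.
move=> ext /left_dual_basis_exists [m [e [f ef]]] h.
have [g gE] := functional_choice _ (fun j => ext (comphom (f j) h)).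
have [||G GE] := @lmod_hom_of_fun _ _ (free_on X) P
  (fun z => \sum_j lact P (g j z) (e j)).
- move=> c u v; rewrite scaler_sumr -big_split; apply: eq_bigr => j _.
  by rewrite linearP lactPE.
- move=> a x; rewrite linear_sum; apply: eq_bigr => j _ /=.
  by rewrite (hom_lactE (g j)) lreg_lactE lactME.
exists G => u; rewrite GE [RHS](ef (h u)); apply: eq_bigr => j _.
by rewrite gE comphomE.
Qed.

Lemma all_ext_projective X P :
  all_ext X (lreg A) -> projective P -> all_ext X P.
Proof. by move=> h pP j; apply: ext1_projective. Qed.

Lemma all_ext_finite_pd X Z :
  all_ext X (lreg A) -> finite_pd Z -> all_ext X Z.
Proof.
move=> h [d]; elim: d Z => [|d IH] Z /=; first exact: all_ext_projective.
move=> [K [P [i [p [e pP /IH hK]]]]].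
exact: all_ext_second e (all_ext_projective h pP) hK.
Qed.

(** An element of the bidual is a functional on the dual; the dual of X is always
    perfectly paired with X on its own side. *)
Lemma biduality_left_perfect X :
  bijective (biduality X) <-> left_perfect (eval_pairing X).
Proof.
split=> [[g gK Kg]|[surj inj]].
  split=> [f|x x0].
    have [w wE] := rdual_of_hom f; exists (g w) => u.
    by rewrite -wE -[in LHS](Kg w); apply: bidualityE.
  rewrite -[x]gK -[RHS]gK; congr (g _); apply: bidual_ext => u.
  by rewrite !bidualityE [LHS]x0 linear0.
have bs : surjective (biduality X).
  move=> w; have [f fE] := rdual_hom w; have [x xE] := surj f.
  by exists x; apply: bidual_ext => u; rewrite bidualityE -[LHS]xE fE.
exists (hfun (biduality X))^-1%VF => x; last exact: lfun_section bs x.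
apply/eqP; rewrite -subr_eq0; apply/eqP/inj => u /=.
rewrite -bidualityE linearB /= (lfun_section bs) subrr.
by apply: rdual0.
Qed.

Lemma gproj_separated X x : gproj X ->
  (forall u : ldual X, lhom_val u x = 0) -> x = 0.
Proof.
move=> /gproj_coresolution [X' [P [i [p [e pP _]]]]] x0.
have [m [a [b ab]]] := eval_dual_bases pP.
have [i' i'E] := ldual_map i.
apply: (short_exact_inj0 e); apply: (dual_bases_left_perfect ab).2 => u.
by rewrite /= -i'E x0.
Qed.

Section DualSequence.
Variables (X X' P : lmod A) (i : bihom X P) (p : bihom P X').
Hypotheses (e : short_exact i p) (ext : ext1_vanishes X' (lreg A)).

Lemma ldual_short_exact : exists (p' : bihom (ldual X') (ldual P))
    (i' : bihom (ldual P) (ldual X)),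
  [/\ short_exact p' i', forall u x, lhom_val (p' u) x = lhom_val u (p x)
    & forall u x, lhom_val (i' u) x = lhom_val u (i x)].
Proof.
have [i' i'E] := ldual_map i; have [p' p'E] := ldual_map p.
exists p', i'; split; [|exact: p'E|exact: i'E].
apply/short_exactP; split=> [u u0|u|u u0|u].
- apply: lhom_ext => x; have [z <-] := short_exact_surj e x.
  by rewrite -p'E u0 !ldual0.
- apply: lhom_ext => x; rewrite i'E p'E (short_exact_comp0 e).
  by rewrite linear0 ldual0.
- have [f fE] := ldual_hom u.
  have [x|g gE] := factor_through_epi (f := f) e.
    by rewrite fE -i'E u0 ldual0.
  have [v vE] := ldual_of_hom g; exists v; apply: lhom_ext => x.
  by rewrite p'E vE gE fE.
- have [f fE] := ldual_hom u; have [g gE] := ext1_extend e ext f.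
  have [v vE] := ldual_of_hom g; exists v; apply: lhom_ext => x.
  by rewrite i'E vE gE fE.
Qed.

End DualSequence.

(** A functional on the dual of X, pulled back to the dual of P, is evaluation at
    some z in P.  It kills the functionals that factor through X', so the image
    of z in X' is killed by all functionals, hence zero, and z lies in X. *)
Lemma gproj_left_perfect X : gproj X -> left_perfect (eval_pairing X).
Proof.
move=> gX; split=> [f|x x0]; last exact: gproj_separated gX x0.
have [X' [P [i [p [e pP gX']]]]] := gproj_coresolution gX.
have [m [a [b ab]]] := eval_dual_bases pP.
have [p' [i' [e' p'E i'E]]] := ldual_short_exact e (gproj_ext1 gX').
have [z zE] := (dual_bases_left_perfect ab).1 (comphom f i').
have [|x xE] := short_exact_ker e (y := z).
  apply: (gproj_separated gX') => u; rewrite -p'E -[LHS]zE [LHS]comphomE.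
  exact: etrans (congr1 f (short_exact_comp0 e' u)) (linear0 _).
exists x => u; have [v <-] := short_exact_surj e' u.
by rewrite -(comphomE f i' v) [LHS]zE /= i'E xE.
Qed.

(** The dual of X' is a syzygy of the dual of X.  In degree one, a functional on
    the dual of X' is evaluation at an element of X', which lifts to P; in higher
    degrees the claim for X is the claim for X' one degree lower. *)
Lemma gproj_all_ext_dual X : gproj X -> all_ext (ldual X) (rreg A).
Proof.
move=> gX j; elim: j => [|j IH] in X gX *;
  have [X' [P [i [p [e pP gX']]]]] := gproj_coresolution gX;
  have [m [a [b ab]]] := eval_dual_bases pP;
  have [p' [i' [e' p'E i'E]]] := ldual_short_exact e (gproj_ext1 gX');
  have pP' := dual_bases_right_projective ab.
- apply: (ext1_of_presentation e' pP') => f.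
  have [x' fE] := (gproj_left_perfect gX').1 f.
  have [z zE] := short_exact_surj e x'.
  have [g gE] := pairing_rhom (eval_pairing P) z.
  by exists g => u; rewrite gE fE /= p'E zE.
- rewrite iterSr; apply: ext1_stable_retract (IH _ gX').
  apply: stable_retract_iter_syz.
  exact: syzygy_stable_retract (syz_short_exact _) e' (@free_projective _ _ _ _) pP'.
Qed.

Lemma gproj_gdim0 X : gproj X -> gdim0 X.
Proof.
move=> gX; split.
- by apply/biduality_left_perfect; apply: gproj_left_perfect.
- exact/all_ext_Ext_vanishes/gproj_all_ext.
- exact/all_ext_Ext_vanishes/gproj_all_ext_dual.
Qed.

(** The coresolving class that contains the modules of Gorenstein dimension zero:
    K is the dual of Z. *)
Definition perfectly_paired Z : Prop :=
  all_ext Z (lreg A) /\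
  exists K (b : pairing Z K),
    [/\ left_perfect b, right_perfect b & all_ext K (rreg A)].

(** Dualise a free presentation W -> F -> K: as Ext^1(K, A) = 0, the sequence
    Z -> F* -> W* is exact, and (W*, W) is again a perfect pair. *)
Lemma perfectly_paired_coresolving : coresolving perfectly_paired.
Proof.
move=> Z [extZ [K [b [lb rb extK]]]]; split=> //.
pose F := free_on K; pose W := syz K.
have pF : projective F by exact: free_projective.
have eK := syz_short_exact K.
have [m [a [c ac]]] := reval_dual_bases pF.
have iP z : exists u : rdual F, forall v, rdual_val u v = b z (cover K v).
  have [f fE] := pairing_rhom b z.
  have [u uE] := rdual_of_hom (comphom f (cover K)).
  by exists u => v; rewrite uE comphomE fE.
have [i0 i0E] := functional_choice _ iP.
have [||i iE] := @lmod_hom_of_fun _ _ Z (rdual F) i0.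
- by move=> s u v; apply: rdual_ext => y; rewrite rdual_valP !i0E pval_linl.
- by move=> s u; apply: rdual_ext => y; rewrite rdual_lact !i0E pval_lact.
have {}iE z v : rdual_val (i z) v = b z (cover K v) by rewrite iE i0E.
have [p pE] := rdual_map (syz_incl K).
have e : short_exact i p.
  apply/short_exactP; split=> [z z0|z|u u0|w].
  - apply: lb.2 => y; have [v <-] := short_exact_surj eK y.
    by rewrite -iE z0 rdual0.
  - apply: rdual_ext => v; rewrite rdual0 pE iE (short_exact_comp0 eK).
    by have [f fE] := pairing_rhom b z; rewrite -fE linear0.
  - have [f fE] := rdual_hom u.
    have [v|g gE] := factor_through_epi (f := f) eK.
      by rewrite fE -pE u0 rdual0.
    have [z zE] := lb.1 g; exists z; apply: rdual_ext => v.
    by rewrite iE -zE gE fE.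
  - have [f fE] := rdual_hom w; have [g gE] := ext1_extend eK (extK 0) f.
    have [u uE] := rdual_of_hom g; exists u; apply: rdual_ext => v.
    by rewrite pE uE gE fE.
exists (rdual W), (rdual F), i, p; split=> //.
  exact: dual_bases_left_projective ac.
split.
  apply: (all_ext_cokernel e (dual_bases_left_projective ac)) extZ => f.
  have [y fE] := rb.1 f; have [v vE] := short_exact_surj eK y.
  have [g gE] := pairing_lhom (reval_pairing F) v.
  by exists g => z; rewrite gE fE /= iE vE.
exists W, (reval_pairing W); split.
- exact: reval_left_perfect.
- split=> [f|w w0].
    have [v vE] := (dual_bases_right_perfect ac).1 (comphom f p).
    have [|w wE] := short_exact_ker eK (y := v).
      apply: rb.2 => z; rewrite -iE -[LHS]vE [LHS]comphomE.
      exact: etrans (congr1 f (short_exact_comp0 e z)) (linear0 _).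
    exists w => u; have [u' <-] := short_exact_surj e u.
    by rewrite -(comphomE f p u') [LHS]vE /= pE wE.
  apply: (short_exact_inj0 eK); apply: (dual_bases_right_perfect ac).2 => u.
  by rewrite /= -pE; apply: w0.
- exact: all_ext_syz.
Qed.

Lemma gdim0_gproj X : gdim0 X -> gproj X.
Proof.
move=> [refl ext extd]; exists perfectly_paired.
  exact: perfectly_paired_coresolving.
split; first exact: Ext_vanishes_all_ext.
exists (ldual X), (eval_pairing X); split.
- exact/biduality_left_perfect.
- exact: eval_right_perfect.
- exact: Ext_vanishes_all_ext.
Qed.

End Gorenstein.

(** * Tensoring with a bimodule projective on both sides *)

Section TensorPure.
Variables (k : fieldType) (A B C : falgType k) (M : bimod A B) (X : bimod B C).

Lemma tens_purePl c (m n : M) (x : X) :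
  tens_pure (c *: m + n) x = c *: tens_pure m x + tens_pure n x.
Proof. exact: (tens_pure_bilin M X).1. Qed.

Lemma tens_purePr c (m : M) (x y : X) :
  tens_pure m (c *: x + y) = c *: tens_pure m x + tens_pure m y.
Proof. exact: (tens_pure_bilin M X).2. Qed.

End TensorPure.

Section TensorExact.
#[local] Opaque free_on syz cover syz_incl comphom addhom opphom idhom.
#[local] Opaque tens tens_pure tens_lift tensmap lhom lhom_val ldual.
Variables (k : fieldType) (A B C : falgType k) (M : bimod A B).
Implicit Types (X Y : bimod B C).

(** A dual basis (e_j, f_j) of M as a right module gives coordinates
    f_j(m) x of m (x) x, natural in X; exactness of the tensor product is
    checked on them. *)
Lemma tens_coordinates : projective (rres M) ->
  exists m (e : 'I_m -> M) (theta : forall X, 'I_m -> 'Hom(tens M X, X)),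
    (forall X t, t = \sum_j tens_pure (e j) (theta X j t)) /\
    (forall X Y (f : bihom X Y) j t,
       theta Y j (tensmap M f t) = f (theta X j t)).
Proof.
move=> /right_dual_basis_exists [m [e [f ef]]].
pose phi X j (n : M) (x : X) : X := lact X (f j n) x.
have phib X j : bilin (phi X j).
  split=> [x|n] c u v; last by rewrite /phi linearP.
  by rewrite /phi linearP lactPE.
have phim X j b n x : phi X j (ract M b n) x = phi X j n (lact X b x).
  by rewrite /phi (hom_ractE (f j) b n) rreg_ractE lactME.
pose theta X j : 'Hom(tens M X, X) := tens_lift (phi X j).
have thetaE X j n x : theta X j (tens_pure n x) = lact X (f j n) x.
  exact: tens_liftE (phib X j) (phim X j) n x.
exists m, e, theta; split=> [X t|X Y g j t].
  have L j : linear (fun t => tens_pure (e j) (theta X j t)).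
    by move=> c u v; rewrite (linearP (theta X j)) tens_purePr.
  have -> : \sum_j tens_pure (e j) (theta X j t) = (\sum_j mklfun (L j)) t.
    by rewrite sum_lfunE; apply: eq_bigr => j _; rewrite mklfunE.
  rewrite -[LHS]id_lfunE; move: t; apply/lfunP; apply: tens_ext => n x.
  rewrite id_lfunE sum_lfunE.
  pose T := mklfun ((tens_pure_bilin M X).1 x).
  have TE n' : T n' = tens_pure n' x by rewrite mklfunE.
  rewrite -TE {1}(ef n) linear_sum; apply: eq_bigr => j _.
  by rewrite /= TE mklfunE TE thetaE tens_balanced.
rewrite -[LHS]comp_lfunE -[RHS]comp_lfunE; move: t; apply/lfunP.
apply: tens_ext => n x; rewrite [LHS]comp_lfunE [RHS]comp_lfunE tensmapE.
by rewrite [LHS]thetaE thetaE [RHS](hom_lactE g).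
Qed.

Lemma tens_exact K P X (i : bihom K P) (p : bihom P X) :
  projective (rres M) -> short_exact i p ->
  short_exact (tensmap M i) (tensmap M p).
Proof.
move=> /tens_coordinates [m [e [theta [tE thetaE]]]] ip.
have pure0 Y (n : M) : tens_pure n (0 : Y) = 0.
  by rewrite -(mklfunE ((tens_pure_bilin M Y).2 n)) linear0.
apply/short_exactP; split=> [t t0|t|t t0|t].
- rewrite (tE _ t); apply: big1 => j _; rewrite (_ : theta K j t = 0) ?pure0 //.
  by apply: (short_exact_inj0 ip); rewrite -thetaE t0 linear0.
- rewrite (tE _ (tensmap M p _)); apply: big1 => j _.
  by rewrite 2!thetaE (short_exact_comp0 ip) pure0.
- have H j : exists u, i u = theta P j t.
    by apply: (short_exact_ker ip); rewrite -thetaE t0 linear0.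
  have [u uE] := functional_choice _ H.
  exists (\sum_j tens_pure (e j) (u j)); rewrite linear_sum [RHS](tE _ t).
  by apply: eq_bigr => j _; rewrite /= -uE; apply: tensmapE.
- have [u uE] := functional_choice _
    (fun j => short_exact_surj ip (theta X j t)).
  exists (\sum_j tens_pure (e j) (u j)); rewrite linear_sum [RHS](tE _ t).
  by apply: eq_bigr => j _; rewrite /= -uE; apply: tensmapE.
Qed.

End TensorExact.

Section TensorHom.
#[local] Opaque free_on syz cover syz_incl comphom addhom opphom idhom.
#[local] Opaque tens tens_pure tens_lift tensmap lhom lhom_val ldual.
Variables (k : fieldType) (A B : falgType k) (M : bimod A B) (X : lmod B).

(** Half of the adjunction Hom_A(M (x) X, A) = Hom_B(X, Hom_A(M, A)), whose other
    half is [tens_uncurry]: it turns Ext over A into Ext over B. *)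
Lemma tens_curry (F : bihom (tens M X) (lreg A)) :
  exists g : bihom X (lres (ldual M)),
    forall x m, lhom_val (g x : ldual M) m = F (tens_pure m x).
Proof.
have H x : exists u : ldual M, forall m, lhom_val u m = F (tens_pure m x).
  have [|u uE] := @lhom_mk _ _ _ _ M (reg A)
    (hfun F \o mklfun ((tens_pure_bilin M X).1 x))%VF.
    move=> a m; rewrite 2!comp_lfunE 2!mklfunE -lact_pure.
    exact: (hom_lactE F).
  by exists u => m; rewrite uE comp_lfunE mklfunE.
have [g gE] := functional_choice _ H.
have [||G GE] := @lmod_hom_of_fun _ _ X (lres (ldual M)) g.
- move=> c x y; apply: lhom_ext => m; rewrite lhom_valP !gE.
  by rewrite tens_purePr linearP.
- move=> b x; apply: lhom_ext => m; rewrite lhom_lactE comp_lfunE !gE.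
  by rewrite tens_balanced.
by exists G => x m; rewrite GE.
Qed.

Lemma tens_uncurry (g : bihom X (lres (ldual M))) :
  exists F : bihom (tens M X) (lreg A),
    forall x m, F (tens_pure m x) = lhom_val (g x : ldual M) m.
Proof.
pose phi (m : M) (x : X) : lreg A := lhom_val (g x : ldual M) m.
have phib : bilin phi.
  split=> [x|m] c u v; first by rewrite /phi linearP.
  by rewrite /phi linearP; apply: lhom_valP.
have phim b m x : phi (ract M b m) x = phi m (lact X b x).
  rewrite /phi (hom_lactE g b x) [RHS](congr1 (fun h : 'Hom(_, _) => h m)
    (lhom_lactE b (g x : ldual M))).
  by rewrite comp_lfunE.
pose F := tens_lift phi.
have FE m x : F (tens_pure m x) = phi m x by apply: tens_liftE phib phim m x.
have [||G GE] := @lmod_hom_of_fun _ _ (tens M X) (lreg A) F.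
- exact: linearP.
- move=> a t; rewrite -[LHS]comp_lfunE -[RHS]comp_lfunE; move: t; apply/lfunP.
  apply: tens_ext => m x.
  rewrite [LHS]comp_lfunE [RHS]comp_lfunE lact_pure 2!FE /phi.
  by rewrite lhom_hom.
by exists G => x m; rewrite GE FE.
Qed.

End TensorHom.

Section TensorGorenstein.
#[local] Opaque free_on syz cover syz_incl comphom addhom opphom idhom.
#[local] Opaque tens tens_pure tens_lift tensmap lhom lhom_val ldual.
Variables (k : fieldType) (A B : falgType k) (M : bimod A B).
Hypotheses (pMl : projective (lres M)) (pMr : projective (rres M)).
Implicit Types (X : lmod B).

Lemma tens_ext1 X : ext1_vanishes X (lres (ldual M)) ->
  ext1_vanishes (tens M X) (lreg A).
Proof.
move=> ext; have e := tens_exact pMr (syz_short_exact X).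
apply: (ext1_of_presentation e).
  by apply: tens_projective => //; apply: free_projective.
move=> f; have [g gE] := tens_curry f; have [G GE] := ext g.
have [F FE] := tens_uncurry G; exists F => u.
rewrite -[LHS]comp_lfunE; move: u; apply/lfunP; apply: tens_ext => m x.
by rewrite comp_lfunE [tensmap M _ _]tensmapE FE GE gE.
Qed.

Hypothesis pdM : finite_pd (lres (ldual M)).

(** A coresolution of X is carried to one of M (x) X.  Ext^j_A(M (x) X, A) is
    Ext^j_B(X, Hom_A(M, A)), and the latter vanishes because X has no Ext into
    projective modules and Hom_A(M, A) has finite projective dimension. *)
Lemma tens_gproj X : gproj X -> gproj (tens M X).
Proof.
move=> gX; exists (fun Z => exists2 X, gproj X & Z = tens M X); last by exists X.
move=> Z [{gX}X gX ->]; split; last first.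
  have [X' [P [i [p [e pP gX']]]]] := gproj_coresolution gX.
  exists (tens M X'), (tens M P), (tensmap M i), (tensmap M p); split.
  - exact: tens_exact.
  - exact: tens_projective.
  - by exists X'.
move=> j; elim: j => [|j IH] in X gX *.
  by apply: tens_ext1; apply: (all_ext_finite_pd (gproj_all_ext gX) pdM (j := 0)).
rewrite iterSr; apply: ext1_stable_retract (IH _ (gproj_syz gX)).
apply: stable_retract_iter_syz.
apply: syzygy_stable_retract (syz_short_exact _)
  (tens_exact pMr (syz_short_exact X)) (@free_projective _ _ _ _) _.
by apply: tens_projective => //; apply: free_projective.
Qed.

End TensorGorenstein.

(** * Tensoring with projective bimodules and their syzygies *)

Section TensorLeft.
Variables (k : fieldType) (A B C : falgType k).

Section Map.
Variables (U V : bimod A B) (X : bimod B C) (f : bihom U V).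

Definition ltensmap_lfun : 'Hom(tens U X, tens V X) :=
  tens_lift (fun (u : U) (x : X) => tens_pure (f u) x).

Lemma ltensmap_lfunE u x : ltensmap_lfun (tens_pure u x) = tens_pure (f u) x.
Proof.
apply: (@tens_liftE _ _ _ _ U X (tens V X) (fun u x => tens_pure (f u) x)).
  have [pl pr] := tens_pure_bilin V X.
  by split=> [y|v] c s t; rewrite ?linearP ?pl ?pr.
by move=> b m y; rewrite hom_ractE tens_balanced.
Qed.

Definition ltensmap : bihom (tens U X) (tens V X).
Proof.
exists ltensmap_lfun => c; apply: tens_ext => m x; rewrite !comp_lfunE.
  by rewrite lact_pure !ltensmap_lfunE lact_pure hom_lactE.
by rewrite ract_pure !ltensmap_lfunE ract_pure.
Defined.

Lemma ltensmapE u x : ltensmap (tens_pure u x) = tens_pure (f u) x.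
Proof. exact: ltensmap_lfunE. Qed.

End Map.
End TensorLeft.

Section ProjectiveBimodule.
#[local] Opaque tens tens_pure tens_lift ltensmap comphom addhom opphom idhom.
Variables (k : fieldType) (A B : falgType k).

(** By the adjunction of - (x) X with Hom_k(X, -), which is exact because k is a
    field. *)
Lemma projective_tens (P : bimod A B) (X : lmod B) :
  projective P -> projective (tens P X).
Proof.
move=> pP Y Z g f gs.
have [||p|F FE] := @bihom_of_fun _ _ _ P (krhom X Z)
  (fun p => (hfun f \o mklfun ((tens_pure_bilin P X).2 p))%VF).
- move=> c p q; apply/lfunP => x; rewrite add_lfunE scale_lfunE !comp_lfunE.
  by rewrite !mklfunE tens_purePl linearP.
- move=> a p; apply/lfunP => x; rewrite /= postcompE !comp_lfunE !mklfunE.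
  by rewrite -hom_lactE lact_pure.
- move=> q; apply/lfunP => x; rewrite /= precompE !comp_lfunE !mklfunE.
  by rewrite tens_balanced.
have [||p|G GE] := @bihom_of_fun _ _ _ (krhom X Y) (krhom X Z)
  (fun h => (hfun g \o h)%VF).
- by move=> c u v; rewrite comp_lfunDr comp_lfunZr.
- move=> a h; apply/lfunP => x; rewrite /= !postcompE !comp_lfunE.
  by rewrite hom_lactE.
- by move=> h; apply/lfunP => x; rewrite /= !precompE !comp_lfunE.
have Gs : surjective G.
  move=> h; exists ((hfun g)^-1 \o (h : 'Hom(X, Z)))%VF.
  by rewrite GE; apply/lfunP => x; rewrite !comp_lfunE (lfun_section gs).
have [H HE] := pP _ _ G F Gs.
pose phi (p : P) (x : X) : Y := (H p : 'Hom(X, Y)) x.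
have phib : bilin phi.
  split=> [x|p] c u v; last by rewrite /phi linearP.
  by rewrite /phi linearP add_lfunE scale_lfunE.
have phim b p x : phi (ract P b p) x = phi p (lact X b x).
  by rewrite /phi hom_ractE /= precompE comp_lfunE.
pose h := tens_lift phi.
have hE p x : h (tens_pure p x) = phi p x by apply: tens_liftE phib phim p x.
have [||h' h'E] := @lmod_hom_of_fun _ _ (tens P X) Y h.
- exact: linearP.
- move=> a t; rewrite -[LHS]comp_lfunE -[RHS]comp_lfunE; move: t; apply/lfunP.
  apply: tens_ext => p x; rewrite [LHS]comp_lfunE [RHS]comp_lfunE.
  rewrite lact_pure 2!hE /phi hom_lactE /=.
  by rewrite postcompE comp_lfunE.
exists h' => t; rewrite h'E -[LHS]comp_lfunE; move: t; apply/lfunP.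
apply: tens_ext => p x; rewrite comp_lfunE hE.
have /(congr1 (fun u : 'Hom(X, Z) => u x)) := HE p.
by rewrite GE FE !comp_lfunE mklfunE.
Qed.

Lemma free_rprojective (U : bimod A B) : projective (rres (free_on U)).
Proof.
move=> Y Z g f gs.
pose phi (t : ktens (reg A) U) (b : reg B) : Y :=
  ract Y b (((hfun g)^-1)%VF (f (tpure t (1 : reg B)))).
have phib : bilin phi.
  split=> [b|t] c u v; last by rewrite /phi ractPE.
  by rewrite /phi tpurePl !linearP.
have [||h hE] := @rmod_hom_of_fun _ _ (rres (free_on U)) Y (tlift phi).
- exact: linearP.
- move=> b t; rewrite -[LHS]comp_lfunE -[RHS]comp_lfunE; move: t; apply/lfunP.
  apply: tspace_ext => t b'; rewrite 2!comp_lfunE /= tmapE id_lfunE !tliftE //.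
  by rewrite /phi lfunE /= ractME.
exists h => t; rewrite hE -[LHS]comp_lfunE; move: t; apply/lfunP.
apply: tspace_ext => t b; rewrite comp_lfunE tliftE // /phi.
rewrite hom_ractE (lfun_section gs) -hom_ractE /= tmapE id_lfunE lfunE /=.
by rewrite mul1r.
Qed.

Section RightSplit.
Variables (K P U : bimod A B) (i : bihom K P) (p : bihom P U).
Hypotheses (e : short_exact i p) (pU : projective (rres U)).

(** Tensor products with X see only the right module structure of the first
    factor, so a sequence that splits on the right stays exact. *)
Lemma right_split : exists (s : bihom (rres U) (rres P))
    (r : bihom (rres P) (rres K)),
  [/\ forall u, p (s u) = u, forall x, r (i x) = x
    & forall y, i (r y) + s (p y) = y].
Proof.
have resh (X Y : bimod A B) (f : bihom X Y) :
    exists f' : bihom (rres X) (rres Y), forall x, f' x = f x.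
  apply: rmod_hom_of_fun => [|b x]; first exact: linearP.
  exact: (hom_ractE f).
have [p' p'E] := resh _ _ p; have [i' i'E] := resh _ _ i.
have e' : short_exact i' p'.
  apply/short_exactP; split=> [x|x|y|u]; rewrite ?i'E ?p'E.
  - exact: short_exact_inj0 e x.
  - exact: short_exact_comp0 e x.
  - by move=> /(short_exact_ker e) [x <-]; exists x; rewrite i'E.
  - by have [x <-] := short_exact_surj e u; exists x; rewrite p'E.
have [s sE] := @pU _ _ p' (idhom _) (short_exact_surj e').
pose q := addhom (idhom (rres P)) (opphom (comphom s p')).
have [y|r rE] := lift_through_mono (f := q) e'.
  by rewrite !bihomE linearB /= sE idhomE subrr.
have rE' y : i (r y) + s (p y) = y.
  by rewrite -i'E rE !bihomE p'E subrK.
exists s, r; split=> // [u|x]; first by rewrite -p'E sE idhomE.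
apply: (short_exact_inj e); have := rE' (i x).
by rewrite (short_exact_comp0 e) linear0 addr0.
Qed.

Lemma kernel_rprojective : projective (rres P) -> projective (rres K).
Proof.
have [s [r [_ ri _]]] := right_split.
have [||i' i'E] := @rmod_hom_of_fun _ _ (rres K) (rres P) i.
- exact: linearP.
- exact: (hom_ractE i).
by apply: (@projective_retract _ _ _ _ _ i' r) => x; rewrite i'E ri.
Qed.

Lemma right_split_tens_exact (C : falgType k) (X : bimod B C) :
  short_exact (ltensmap X i) (ltensmap X p).
Proof.
have [s [r [ps ri isE]]] := right_split.
have lmap (V W : bimod A B) (f : bihom (rres V) (rres W)) :
    exists F : 'Hom(tens V X, tens W X),
      forall v x, F (tens_pure v x) = tens_pure (f v : W) x.
  pose phi (v : V) (x : X) : tens W X := tens_pure (f v : W) x.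
  exists (tens_lift phi); apply: tens_liftE.
    have [pl pr] := tens_pure_bilin W X.
    by split=> [x|v] c u w; rewrite /phi ?linearP ?pl ?pr.
  by move=> b v x; rewrite /phi (hom_ractE f b v) -tens_balanced.
have [S SE] := lmap _ _ s; have [R RE] := lmap _ _ r.
have RI t : R (ltensmap X i t) = t.
  rewrite -[LHS]comp_lfunE -[RHS]id_lfunE; move: t; apply/lfunP.
  by apply: tens_ext => v x; rewrite comp_lfunE id_lfunE ltensmapE RE ri.
have PS t : ltensmap X p (S t) = t.
  rewrite -[LHS]comp_lfunE -[RHS]id_lfunE; move: t; apply/lfunP.
  by apply: tens_ext => v x; rewrite comp_lfunE id_lfunE SE ltensmapE ps.
have IR t : ltensmap X i (R t) + S (ltensmap X p t) = t.
  rewrite -!comp_lfunE -add_lfunE -[RHS]id_lfunE; move: t; apply/lfunP.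
  apply: tens_ext => v x; rewrite add_lfunE 2!comp_lfunE id_lfunE.
  rewrite RE !ltensmapE SE -[in RHS](isE v).
  by have := (tens_pure_bilin P X).1 x 1 (i (r v)) (s (p v));
    rewrite !scale1r.
apply/short_exactP; split=> [t t0|t|t t0|t].
- by rewrite -[t]RI t0 linear0.
- rewrite -[LHS]comp_lfunE -[RHS](zero_lfunE _ t); move: t; apply/lfunP.
  apply: tens_ext => v x; rewrite comp_lfunE zero_lfunE !ltensmapE.
  rewrite (short_exact_comp0 e).
  by rewrite -(mklfunE ((tens_pure_bilin U X).1 x)) linear0.
- by exists (R t); rewrite -[RHS]IR t0 linear0 addr0.
- by exists (S t); rewrite PS.
Qed.

End RightSplit.
End ProjectiveBimodule.

(** * The composite of the two tensor functors is a syzygy functor *)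

Section Isos.
Variable C : category.

Lemma is_iso_comp (X Y Z : C) (g : hom Y Z) (f : hom X Y) :
  is_iso g -> is_iso f -> is_iso (comp g f).
Proof.
move=> [g' [g'g gg']] [f' [f'f ff']]; exists (comp f' g'); split.
  apply: heq_trans (compA _ _ _) _; apply: heq_trans f'f.
  apply: comp_heq; last exact: heq_refl.
  apply: heq_trans (heq_sym (compA _ _ _)) _.
  by apply: heq_trans (comp1r _); apply: comp_heq => //; apply: heq_refl.
apply: heq_trans (compA _ _ _) _; apply: heq_trans gg'.
apply: comp_heq; last exact: heq_refl.
apply: heq_trans (heq_sym (compA _ _ _)) _.
by apply: heq_trans (comp1r _); apply: comp_heq => //; apply: heq_refl.
Qed.

Lemma fmap_iso (D : category) (F : functor C D) (X Y : C) (f : hom X Y) :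
  is_iso f -> is_iso (fmap F f).
Proof.
move=> [g [gf fg]]; exists (fmap F g); split.
  apply: heq_trans (heq_sym (fmapM F g f)) _.
  exact: heq_trans (fmap_heq F gf) (fmap1 F X).
apply: heq_trans (heq_sym (fmapM F f g)) _.
exact: heq_trans (fmap_heq F fg) (fmap1 F Y).
Qed.

End Isos.

(** Liftings of maps exist but are not canonical; a natural transformation needs
    one of them for every module. *)
Lemma dependent_choice (T : Type) (U : T -> Type) (R : forall x, U x -> Prop) :
  (forall x, exists y, R x y) -> exists f : forall x, U x, forall x, R x (f x).
Proof.
move=> H; exists (fun x => sval (constructive_indefinite_description _ (H x))).
by move=> x; apply: proj2_sig.
Qed.

Section StablyNatural.
#[local] Opaque free_on syz cover syz_incl comphom addhom opphom idhom.
#[local] Opaque tens tens_pure tens_lift tensmap ltensmap.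
Variables (k : fieldType) (B : falgType k).
Implicit Types (X Y : lmod B).

(** The object and morphism parts of a functor.  There are no laws, so that
    tensoring with any bimodule qualifies, even one that does not preserve
    projectives. *)
Record module_map := ModuleMap {
  mob :> lmod B -> lmod B;
  mmap : forall X Y, bihom X Y -> bihom (mob X) (mob Y)
}.

Definition stably_natural_iso (F G : module_map) : Prop :=
  exists eta : forall X, bihom (F X) (G X),
    (forall X, @is_iso (stab B k^o) (F X) (G X) (eta X)) /\
    (forall X Y (f : bihom X Y),
       stable_eq (comphom (eta Y) (mmap F f)) (comphom (mmap G f) (eta X))).

Lemma stably_natural_iso_trans F G H :
  stably_natural_iso F G -> stably_natural_iso G H -> stably_natural_iso F H.
Proof.
move=> [eta [etaI etaN]] [eps [epsI epsN]].
exists (fun X => comphom (eps X) (eta X)); split=> [X|X Y f].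
  exact: (@is_iso_comp (stab B k^o) _ _ _ (eps X) (eta X)).
pose S := stab B k^o.
apply: (@heq_trans S _ _ _ (comphom (eps Y) (comphom (eta Y) (mmap F f)))).
  exact: (@heq_sym S _ _ _ _ (@compA S _ _ _ _ (eps Y) (eta Y) (mmap F f))).
apply: (@heq_trans S _ _ _ (comphom (eps Y) (comphom (mmap G f) (eta X)))).
  exact: (@comp_heq S _ _ _ _ _ _ _ (@heq_refl S _ _ (eps Y)) (etaN X Y f)).
apply: (@heq_trans S _ _ _ (comphom (comphom (eps Y) (mmap G f)) (eta X))).
  exact: (@compA S _ _ _ _ (eps Y) (mmap G f) (eta X)).
apply: (@heq_trans S _ _ _ (comphom (comphom (mmap H f) (eps X)) (eta X))).
  exact: (@comp_heq S _ _ _ _ _ _ _ (epsN X Y f) (@heq_refl S _ _ (eta X))).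
exact: (@heq_sym S _ _ _ _ (@compA S _ _ _ _ (mmap H f) (eps X) (eta X))).
Qed.

Definition of_functor (F : functor (stab B k^o) (stab B k^o)) : module_map :=
  @ModuleMap (fob F) (@fmap _ _ F).

Definition tens_map (U : bimod B B) : module_map :=
  @ModuleMap (@tens k B B k^o U) (@tensmap k B B k^o U).

Definition syz_after (F : module_map) : module_map :=
  @ModuleMap (fun X => syz (F X)) (fun X Y f => syz_map (mmap F f)).

Lemma stably_natural_iso_syz F G :
  stably_natural_iso F G -> stably_natural_iso (syz_after F) (syz_after G).
Proof.
move=> [eta [etaI etaN]]; pose S := stab B k^o; pose O := syz_functor B k^o.
exists (fun X => syz_map (eta X)); split=> [X|X Y f].
  exact: (fmap_iso O (etaI X)).
apply: (@heq_trans S _ _ _ (syz_map (comphom (eta Y) (mmap F f)))).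
  exact: (@heq_sym S _ _ _ _ (@fmapM _ _ O _ _ _ (eta Y) (mmap F f))).
apply: (@heq_trans S _ _ _ (syz_map (comphom (mmap G f) (eta X)))).
  exact: (@fmap_heq _ _ O _ _ _ _ (etaN X Y f)).
exact: (@fmapM _ _ O _ _ _ (mmap G f) (eta X)).
Qed.

(** Functorial presentations K -> P -> F by projectives identify K with the
    syzygy of F.  The liftings are chosen arbitrarily, and are natural because
    liftings are stably unique. *)
Lemma lift_natural (F K P : module_map)
    (i : forall X, bihom (K X) (P X)) (p : forall X, bihom (P X) (F X)) :
  (forall X, short_exact (i X) (p X)) -> (forall X, projective (P X)) ->
  (forall X Y (f : bihom X Y),
     lifts_to (i X) (p X) (i Y) (p Y) (mmap K f) (mmap F f)) ->
  stably_natural_iso K (syz_after F).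
Proof.
move=> e pP nat.
have [eta etaE] := dependent_choice
  (fun X => lifts_to_exists (idhom (F X)) (e X) (syz_short_exact _) (pP X)).
exists eta; split=> [X|X Y f].
  apply: lifts_to_iso (e X) (syz_short_exact _) (pP X) _ (etaE X).
  exact: free_projective.
apply: (lifts_to_unique (lambda := mmap F f) (syz_short_exact _) (pP X)).
  apply: (lifts_to_ext _ (lifts_to_comp (etaE Y) (nat X Y f))) => x.
  by rewrite comphomE idhomE.
apply: (lifts_to_ext _ (lifts_to_comp (syz_map_lifts (mmap F f)) (etaE X))) => x.
by rewrite comphomE idhomE.
Qed.

Lemma ltensmap_tensmap (U V : bimod B B) (h : bihom U V) X Y (f : bihom X Y) t :
  ltensmap Y h (tensmap U f t) = tensmap V f (ltensmap X h t).
Proof.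
rewrite -[LHS]comp_lfunE -[RHS]comp_lfunE; move: t; apply/lfunP.
apply: tens_ext => u x; rewrite [LHS]comp_lfunE [RHS]comp_lfunE.
by rewrite (tensmapE f u x) [LHS]ltensmapE (ltensmapE h u x) [RHS]tensmapE.
Qed.

Lemma tens_syz_natural (U : bimod B B) : projective (rres U) ->
  stably_natural_iso (tens_map (syz U)) (syz_after (tens_map U)).
Proof.
move=> pU; have e := syz_short_exact U.
apply: (@lift_natural (tens_map U) (tens_map (syz U)) (tens_map (free_on U))
  (fun X => ltensmap X (syz_incl U)) (fun X => ltensmap X (cover U))).
- by move=> X; apply: right_split_tens_exact.
- by move=> X; apply: projective_tens; apply: free_projective.
- move=> X Y f; exists (tensmap (free_on U) f); split=> t.
    exact/esym/ltensmap_tensmap.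
  exact: ltensmap_tensmap.
Qed.

Lemma stable_eq_ltensmap (U V : bimod B B) (f g : bihom U V) X :
  stable_eq f g -> stable_eq (ltensmap X f) (ltensmap X g).
Proof.
move=> [P [u [v [pP e]]]].
exists (tens P X), (ltensmap X u), (ltensmap X v); split.
  exact: projective_tens.
apply: tens_ext => w x; rewrite add_lfunE opp_lfunE [RHS]comp_lfunE.
rewrite [ltensmap X f _]ltensmapE [ltensmap X g _]ltensmapE.
rewrite [ltensmap X u _]ltensmapE [RHS]ltensmapE -[v _]comp_lfunE -e.
by rewrite add_lfunE opp_lfunE addrC -scaleN1r -tens_purePl scaleN1r addrC.
Qed.

Lemma tens_stable_natural (U V : bimod B B) (f : bihom U V) :
  @is_iso (stab B B) U V f -> stably_natural_iso (tens_map U) (tens_map V).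
Proof.
move=> [g [gf fg]].
have compE (U1 U2 U3 : bimod B B) (h2 : bihom U2 U3) (h1 : bihom U1 U2) X :
    stable_eq (comphom (ltensmap X h2) (ltensmap X h1)) (ltensmap X (comphom h2 h1)).
  apply: stable_eq_hfun; apply: tens_ext => u x.
  by rewrite [LHS]comp_lfunE [ltensmap X h1 _]ltensmapE !ltensmapE comphomE.
have idE (U1 : bimod B B) X : stable_eq (ltensmap X (idhom U1)) (idhom (tens U1 X)).
  apply: stable_eq_hfun; apply: tens_ext => u x.
  by rewrite ltensmapE !idhomE.
exists (fun X => ltensmap X f); split=> [X|X Y h].
  exists (ltensmap X g); split.
    apply: stable_eq_trans (compE _ _ _ _ _ _) _.
    exact: stable_eq_trans (stable_eq_ltensmap X gf) (idE _ _).
  apply: stable_eq_trans (compE _ _ _ _ _ _) _.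
  exact: stable_eq_trans (stable_eq_ltensmap X fg) (idE _ _).
apply: stable_eq_hfun; apply/lfunP => t; rewrite [LHS]comp_lfunE [RHS]comp_lfunE.
exact: ltensmap_tensmap.
Qed.

Lemma tens_reg_natural :
  stably_natural_iso (tens_map (reg B)) (of_functor (id_functor _)).
Proof.
have H X : exists2 eta : bihom (tens (reg B) X) X,
    (forall b x, eta (tens_pure b x) = lact X b x) &
    @is_iso (stab B k^o) _ _ eta.
  pose phi (b : reg B) (x : X) : X := lact X b x.
  have phib : bilin phi.
    by split=> [x|b] c u v; rewrite /phi ?linearP ?lactPE.
  have phim b c x : phi (ract (reg B) b c) x = phi c (lact X b x).
    by rewrite /phi reg_ractE lactME.
  pose h := tens_lift phi.
  have hE b x : h (tens_pure b x) = lact X b x by apply: tens_liftE phib phim b x.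
  have [||eta etaE] := @lmod_hom_of_fun _ _ (tens (reg B) X) X h.
  - exact: linearP.
  - move=> a t; rewrite -[LHS]comp_lfunE -[RHS]comp_lfunE; move: t; apply/lfunP.
    apply: tens_ext => b x; rewrite [LHS]comp_lfunE [RHS]comp_lfunE lact_pure.
    by rewrite 2!hE reg_lactE lactME.
  exists eta; first by move=> b x; rewrite etaE hE.
  have [||g gE] := @lmod_hom_of_fun _ _ X (tens (reg B) X)
    (fun x => tens_pure (1 : reg B) x).
  - by move=> c x y; rewrite tens_purePr.
  - by move=> b x; rewrite lact_pure -tens_balanced reg_lactE reg_ractE mulr1 mul1r.
  exists g; split; apply: stable_eq_hfun.
    apply: tens_ext => b x; rewrite [LHS]comp_lfunE id_lfunE etaE hE gE.
    by rewrite -tens_balanced reg_ractE mul1r.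
  by apply/lfunP => x; rewrite [LHS]comp_lfunE id_lfunE gE etaE hE lact1E.
have H' X : exists eta : bihom (tens (reg B) X) X,
    (forall b x, eta (tens_pure b x) = lact X b x) /\
    @is_iso (stab B k^o) _ _ eta.
  by have [eta etaE etaI] := H X; exists eta.
have [eta etaP] := dependent_choice H'.
exists eta; split=> [X|X Y f]; first exact: (etaP X).2.
apply: stable_eq_hfun; apply: tens_ext => b x.
rewrite [LHS]comp_lfunE [RHS]comp_lfunE [tensmap _ _ _]tensmapE.
by rewrite (etaP Y).1 (etaP X).1 [RHS](hom_lactE f).
Qed.

Lemma reg_rprojective : projective (rreg B).
Proof.
move=> Y Z g f gs.
have [||h hE] := @rmod_hom_of_fun _ _ (rreg B) Y
  (fun b => ract Y b (((hfun g)^-1)%VF (f (1 : B)))).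
- by move=> c u v; rewrite ractPE.
- by move=> b c; rewrite rreg_ractE ractME.
exists h => b; rewrite hE hom_ractE (lfun_section gs).
by rewrite -(hom_ractE f) rreg_ractE mul1r.
Qed.

Lemma iter_syz_rprojective n : projective (rres (iter n (@syz k B B) (reg B))).
Proof.
elim: n => [|n IH] /=; first exact: reg_rprojective.
apply: (kernel_rprojective (syz_short_exact _) IH).
exact: free_rprojective.
Qed.

(** The syzygies of the bimodule B remain projective on the right, so tensoring
    turns a bimodule presentation into one of left modules. *)
Lemma tens_iter_syz_natural n :
  stably_natural_iso (tens_map (iter n (@syz k B B) (reg B)))
    (of_functor (iter_functor n (syz_functor B k^o))).
Proof.
elim: n => [|n IH]; first exact: tens_reg_natural.
have pU := @iter_syz_rprojective n.
refine (stably_natural_iso_trans (tens_syz_natural pU) _).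
exact: stably_natural_iso_syz IH.
Qed.

End StablyNatural.

Section Associativity.
#[local] Opaque free_on syz cover syz_incl comphom addhom opphom idhom.
#[local] Opaque tens tens_pure tens_lift tensmap ltensmap.
Variables (k : fieldType) (A B : falgType k) (M : bimod A B) (N : bimod B A).

Definition tens_tens_map : module_map B :=
  @ModuleMap k B (fun X => tens N (tens M X))
    (fun X Y f => tensmap N (tensmap M f)).

Section Assoc.
Variable X : lmod B.

Lemma tens_assoc_exists : exists f : bihom (tens N (tens M X)) (tens (tens N M) X),
  forall n m x, f (tens_pure n (tens_pure m x)) = tens_pure (tens_pure n m) x.
Proof.
pose phi n (m : M) (x : X) : tens (tens N M) X := tens_pure (tens_pure n m) x.
have phib n : bilin (phi n).
  by split=> [x|m] c u v; rewrite /phi !(tens_purePr, tens_purePl).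
have phim n b m x : phi n (ract M b m) x = phi n m (lact X b x).
  by rewrite /phi -ract_pure tens_balanced.
have phiE n m x : tens_lift (phi n) (tens_pure m x) = phi n m x.
  exact: tens_liftE (phib n) (phim n) m x.
pose psi (n : N) (t : tens M X) := tens_lift (phi n) t.
have psib : bilin psi.
  split=> [t|n] c u v; last by rewrite /psi linearP.
  rewrite /psi -scale_lfunE -add_lfunE; move: t; apply/lfunP.
  apply: tens_ext => m x.
  rewrite [LHS]phiE [RHS]add_lfunE [X in _ = X + _]scale_lfunE 2!phiE /phi.
  by rewrite !tens_purePl.
have psim a n t : psi (ract N a n) t = psi n (lact (tens M X) a t).
  rewrite /psi -[RHS]comp_lfunE; move: t; apply/lfunP.
  apply: tens_ext => m x; rewrite [RHS]comp_lfunE lact_pure 2!phiE /phi.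
  by rewrite tens_balanced.
pose h := tens_lift psi.
have hE n m x : h (tens_pure n (tens_pure m x)) = tens_pure (tens_pure n m) x.
  by rewrite [LHS](tens_liftE psib psim); apply: phiE.
have [||f fE] := @lmod_hom_of_fun _ _ _ (tens (tens N M) X) h.
- exact: linearP.
- move=> b t; rewrite -[LHS]comp_lfunE -[RHS]comp_lfunE; move: t; apply/lfunP.
  apply: tens_ext => n t; rewrite [LHS]comp_lfunE [RHS]comp_lfunE lact_pure.
  rewrite [LHS](tens_liftE psib psim) [h _](tens_liftE psib psim) /psi.
  rewrite -[RHS]comp_lfunE; move: t; apply/lfunP; apply: tens_ext => m x.
  by rewrite [RHS]comp_lfunE 2!phiE /phi !lact_pure.
by exists f => n m x; rewrite fE hE.
Qed.

Lemma tens_assoc_inverse : exists f : bihom (tens (tens N M) X) (tens N (tens M X)),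
  forall n m x, f (tens_pure (tens_pure n m) x) = tens_pure n (tens_pure m x).
Proof.
pose phi x (n : N) (m : M) : tens N (tens M X) := tens_pure n (tens_pure m x).
have phib x : bilin (phi x).
  by split=> [m|n] c u v; rewrite /phi !(tens_purePr, tens_purePl).
have phim x a n m : phi x (ract N a n) m = phi x n (lact M a m).
  by rewrite /phi tens_balanced lact_pure.
have phiE x n m : tens_lift (phi x) (tens_pure n m) = phi x n m.
  exact: tens_liftE (phib x) (phim x) n m.
pose psi (t : tens N M) (x : X) := tens_lift (phi x) t.
have psib : bilin psi.
  split=> [x|t] c u v; first by rewrite /psi linearP.
  rewrite /psi -scale_lfunE -add_lfunE; move: t; apply/lfunP.
  apply: tens_ext => n m.
  rewrite [LHS]phiE [RHS]add_lfunE [X in _ = X + _]scale_lfunE 2!phiE /phi.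
  by rewrite !tens_purePr.
have psim b t x : psi (ract (tens N M) b t) x = psi t (lact X b x).
  rewrite /psi -[LHS]comp_lfunE; move: t; apply/lfunP.
  apply: tens_ext => n m; rewrite [LHS]comp_lfunE ract_pure 2!phiE /phi.
  by rewrite tens_balanced.
pose h := tens_lift psi.
have hE n m x : h (tens_pure (tens_pure n m) x) = tens_pure n (tens_pure m x).
  by rewrite [LHS](tens_liftE psib psim); apply: phiE.
have [||f fE] := @lmod_hom_of_fun _ _ (tens (tens N M) X) (tens N (tens M X)) h.
- exact: linearP.
- move=> b t; rewrite -[LHS]comp_lfunE -[RHS]comp_lfunE; move: t; apply/lfunP.
  apply: tens_ext => t x; rewrite [LHS]comp_lfunE [RHS]comp_lfunE lact_pure.
  rewrite [LHS](tens_liftE psib psim) [h _](tens_liftE psib psim) /psi.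
  rewrite -[LHS]comp_lfunE -[RHS]comp_lfunE; move: t; apply/lfunP.
  apply: tens_ext => n m; rewrite [LHS]comp_lfunE [RHS]comp_lfunE lact_pure.
  by rewrite 2!phiE /phi lact_pure.
by exists f => n m x; rewrite fE hE.
Qed.

End Assoc.

Lemma tens_nest_right_ext (X : lmod B) (Z : vectType k)
    (f g : 'Hom(tens N (tens M X), Z)) :
  (forall n m x, f (tens_pure n (tens_pure m x)) =
     g (tens_pure n (tens_pure m x))) ->
  f = g.
Proof.
move=> fg; apply: tens_ext => n t.
pose i := mklfun ((tens_pure_bilin N (tens M X)).2 n).
have: (f \o i = g \o i)%VF.
  by apply: tens_ext => m x; rewrite [LHS]comp_lfunE [RHS]comp_lfunE !mklfunE.
by move=> /lfunP/(_ t); rewrite 2!comp_lfunE !mklfunE.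
Qed.

Lemma tens_nest_left_ext (X : lmod B) (Z : vectType k)
    (f g : 'Hom(tens (tens N M) X, Z)) :
  (forall n m x, f (tens_pure (tens_pure n m) x) =
     g (tens_pure (tens_pure n m) x)) ->
  f = g.
Proof.
move=> fg; apply: tens_ext => t x.
pose i := mklfun ((tens_pure_bilin (tens N M) X).1 x).
have: (f \o i = g \o i)%VF.
  by apply: tens_ext => m y; rewrite [LHS]comp_lfunE [RHS]comp_lfunE !mklfunE.
by move=> /lfunP/(_ t); rewrite 2!comp_lfunE !mklfunE.
Qed.

Lemma tens_assoc_natural :
  stably_natural_iso tens_tens_map (tens_map (tens N M)).
Proof.
have [eta etaE] := dependent_choice tens_assoc_exists.
exists eta; split=> [X|X Y f].
  have [g gE] := tens_assoc_inverse X.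
  exists g; split; apply: stable_eq_hfun.
    by apply: tens_nest_right_ext => n m x; rewrite [LHS]comp_lfunE id_lfunE etaE gE.
  by apply: tens_nest_left_ext => n m x; rewrite [LHS]comp_lfunE id_lfunE gE etaE.
apply: stable_eq_hfun; apply: tens_nest_right_ext => n m x.
rewrite [LHS]comp_lfunE [RHS]comp_lfunE [tensmap N _ _]tensmapE.
rewrite [tensmap M _ _]tensmapE [LHS]etaE etaE.
by rewrite [RHS]tensmapE.
Qed.

End Associativity.

(** * Equivalences from fully faithful dense functors *)

Section Equivalences.

#[local] Instance heq_equivalence (C : category) (X Y : C) :
  Equivalence (@heq C X Y).
Proof.
split; [exact: heq_refl|exact: heq_sym|exact: heq_trans].
Qed.

#[local] Instance comp_proper (C : category) (X Y Z : C) :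
  Proper (@heq C Y Z ==> @heq C X Y ==> @heq C X Z) (@comp C X Y Z).
Proof. by move=> g g' gg' f f' ff'; apply: comp_heq. Qed.

#[local] Instance fmap_proper (C D : category) (F : functor C D) (X Y : C) :
  Proper (@heq C X Y ==> @heq D (F X) (F Y)) (@fmap C D F X Y).
Proof. by move=> f g fg; apply: fmap_heq. Qed.

(** Relative to object classes, so that functors on a category and on its full
    subcategories are treated alike. *)
Record fully_faithful_on (C D : category) (P : C -> Prop) (Q : D -> Prop)
    (F : functor C D) : Prop := FullyFaithfulOn {
  ff_faithful : forall X Y (f g : hom X Y), P X -> P Y ->
    heq (fmap F f) (fmap F g) -> heq f g;
  ff_full : forall X Y (h : hom (F X) (F Y)), P X -> P Y ->
    exists f : hom X Y, heq (fmap F f) h;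
  ff_dense : forall Y, Q Y -> exists2 X, P X & isomorphic (F X) Y
}.

Definition whole (C : category) : C -> Prop := fun _ => True.
Arguments whole : clear implicits.

Definition weak_equivalence (C D : category) (F : functor C D) : Prop :=
  fully_faithful_on (whole C) (whole D) F.

Lemma weak_equivalence_full (C D : category) (P : C -> Prop) (Q : D -> Prop)
    (F : functor C D) (FPQ : forall X, P X -> Q (F X)) :
  fully_faithful_on P Q F -> weak_equivalence (full_functor FPQ).
Proof.
move=> [fa fu de]; split.
- by move=> [X PX] [Y PY] f g _ _; apply: fa.
- by move=> [X PX] [Y PY] h _ _; have [f fE] := fu X Y h PX PY; exists f.
- move=> [Y QY] _; have [X PX [f [g fg]]] := de Y QY.
  by exists (exist _ X PX) => //; exists f, g.
Qed.

Lemma isomorphic_trans (C : category) (X Y Z : C) :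
  isomorphic X Y -> isomorphic Y Z -> isomorphic X Z.
Proof. by move=> [f fi] [g gi]; exists (comp g f); apply: is_iso_comp. Qed.

Lemma isomorphic_fmap (C D : category) (F : functor C D) (X Y : C) :
  isomorphic X Y -> isomorphic (F X) (F Y).
Proof. by move=> [f fi]; exists (fmap F f); apply: fmap_iso. Qed.

Lemma fully_faithful_on_id (C : category) (P : C -> Prop) :
  fully_faithful_on P P (id_functor C).
Proof.
split=> [//|X Y h _ _|Y PY]; first by exists h; apply: heq_refl.
exists Y => //; exists (ident Y), (ident Y).
by split; apply: comp1l.
Qed.

Lemma fully_faithful_on_comp (C D E : category) (P : C -> Prop) (Q : D -> Prop)
    (R : E -> Prop) (F : functor C D) (G : functor D E) :
  (forall X, P X -> Q (F X)) ->
  fully_faithful_on P Q F -> fully_faithful_on Q R G ->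
  fully_faithful_on P R (comp_functor G F).
Proof.
move=> FPQ [faF fuF deF] [faG fuG deG]; split.
- move=> X Y f g PX PY /(faG _ _ _ _ (FPQ _ PX) (FPQ _ PY)).
  exact: faF.
- move=> X Y h PX PY; have [g gE] := fuG _ _ h (FPQ _ PX) (FPQ _ PY).
  have [f fE] := fuF _ _ g PX PY; exists f => /=.
  by rewrite fE.
- move=> Z /deG [Y QY YZ]; have [X PX XY] := deF Y QY.
  exists X => //; exact: isomorphic_trans (isomorphic_fmap G XY) YZ.
Qed.

Lemma weak_equivalence_is_equivalence (C D : category) (F : functor C D) :
  weak_equivalence F -> is_equivalence F.
Proof.
move=> [fa fu de].
have H Y : exists Xe : {X : C & (hom (F X) Y * hom Y (F X))%type},
    heq (comp (projT2 Xe).2 (projT2 Xe).1) (ident _) /\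
    heq (comp (projT2 Xe).1 (projT2 Xe).2) (ident _).
  by have [X _ [e [e' ee']]] := de Y I; exists (existT _ X (e, e')).
have [c cE] := dependent_choice H.
pose g Y := projT1 (c Y); pose e Y : hom (F (g Y)) Y := (projT2 (c Y)).1.
pose e' Y : hom Y (F (g Y)) := (projT2 (c Y)).2.
have e'e Y : heq (comp (e' Y) (e Y)) (ident _) := (cE Y).1.
have ee' Y : heq (comp (e Y) (e' Y)) (ident _) := (cE Y).2.
have Hm (Y Z : D) (h : hom Y Z) : exists f : hom (g Y) (g Z),
    heq (fmap F f) (comp (e' Z) (comp h (e Y))) by apply: fu.
pose gm Y Z h := sval (constructive_indefinite_description _ (Hm Y Z h)).
have gmE Y Z h : heq (fmap F (gm Y Z h)) (comp (e' Z) (comp h (e Y))).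
  exact: proj2_sig (constructive_indefinite_description _ (Hm Y Z h)).
have gm_heq Y Z (h h' : hom Y Z) : heq h h' -> heq (gm _ _ h) (gm _ _ h').
  by move=> hh'; apply: fa => //; rewrite !gmE hh'; apply: heq_refl.
have gm1 Y : heq (gm _ _ (ident Y)) (ident _).
  by apply: fa => //; rewrite gmE comp1l e'e fmap1; apply: heq_refl.
have gmM X Y Z (h : hom Y Z) (h' : hom X Y) :
    heq (gm _ _ (comp h h')) (comp (gm _ _ h) (gm _ _ h')).
  apply: fa => //; rewrite fmapM !gmE.
  rewrite -!compA (compA (e Y)) ee' comp1l; apply: heq_refl.
exists (Functor gm_heq gm1 gmM); split.
  have He X : exists eta : hom (g (F X)) X, heq (fmap F eta) (e (F X)) by apply: fu.
  have [eta etaE] := dependent_choice He.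
  exists eta; split=> [X|X Y f].
    have [eps epsE] : exists eps : hom X (g (F X)), heq (fmap F eps) (e' (F X)).
      exact: fu.
    exists eps; split; apply: fa => //; rewrite fmapM epsE etaE fmap1.
      exact: e'e.
    exact: ee'.
  apply: fa => //=; rewrite !fmapM !etaE gmE compA ee' comp1l; apply: heq_refl.
exists e; split=> [Y|Y Z h] /=; first by exists (e' Y).
by rewrite gmE compA ee' comp1l; apply: heq_refl.
Qed.

Lemma weak_equivalence_nat_iso (C D : category) (F G : functor C D) :
  nat_iso F G -> weak_equivalence G -> weak_equivalence F.
Proof.
move=> [eta [etaI nat]] [fa fu de].
have E X Y (f : hom X Y) (h : hom (F X) (F Y)) :
    heq (comp (eta Y) h) (comp (fmap G f) (eta X)) -> heq (fmap F f) h.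
  have [i [ie ei]] := etaI Y => hE.
  rewrite -(comp1l (fmap F f)) -ie -compA nat -hE compA ie comp1l.
  exact: heq_refl.
split.
- move=> X Y f g _ _ fg; apply: fa => //.
  have [i [ie ei]] := etaI X.
  rewrite -(comp1r (fmap G f)) -ei compA -nat fg nat -compA ei comp1r.
  exact: heq_refl.
- move=> X Y h _ _; have [i [ie ei]] := etaI X.
  have [f fE] := fu X Y (comp (eta Y) (comp h i)) I I.
  by exists f; apply: E; rewrite fE -!compA ie comp1r; apply: heq_refl.
- move=> Y _; have [X _ XY] := de Y I; exists X => //.
  by apply: isomorphic_trans XY; exists (eta X).
Qed.

(** A preimage under G F of G h is one of h under F, because G can be cancelled:
    F G is faithful. *)
Lemma weak_equivalence_two_sided (C D : category) (F : functor C D)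
    (G : functor D C) :
  weak_equivalence (comp_functor G F) -> weak_equivalence (comp_functor F G) ->
  weak_equivalence F.
Proof.
move=> [fa fu de] [fa' fu' de']; split.
- move=> X Y f g _ _ fg; apply: fa => //=; rewrite fg; apply: heq_refl.
- move=> X Y h _ _; have [f fE] := fu X Y (fmap G h) I I; exists f.
  by apply: fa' => //=; rewrite (fE : heq (fmap G (fmap F f)) _); apply: heq_refl.
- by move=> Y _; have [X _ XY] := de' Y I; exists (G X).
Qed.

End Equivalences.

(** * The syzygy functor on modules of Gorenstein dimension zero *)

Section SyzygyEquivalence.
Variables (k : fieldType) (A : falgType k).
Implicit Types (X Y : lmod A).
#[local] Opaque free_on syz cover syz_incl comphom addhom opphom idhom.

(** As Ext^1(X, -) vanishes on projective modules, h extends to the free covers,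
    and the extension induces a map X -> Y on cokernels. *)
Lemma syz_functor_full X Y (h : bihom (syz X) (syz Y)) : gproj X ->
  exists f : bihom X Y, stable_eq (syz_map f) h.
Proof.
move=> gX; have eX := syz_short_exact X; have eY := syz_short_exact Y.
have [H HE] := ext1_projective (gproj_ext1 gX) (@free_projective _ _ _ Y)
  (comphom (syz_incl Y) h).
have [|f fE] := factor_through_epi (f := comphom (cover Y) H) eX.
  by move=> u; rewrite comphomE HE comphomE (short_exact_comp0 eY).
exists f; apply: (lifts_to_unique (lambda := f) eY (@free_projective _ _ _ X)).
  exact: syz_map_lifts.
by exists H; split=> z; rewrite ?HE ?fE comphomE.
Qed.

(** If syz f - syz g factors through a projective Q, the map into Q extends to
    the free cover of X.  Subtracting it from the lift of f - g leaves a map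
    that kills the syzygy of X, thus a factorisation of f - g through the
    free cover of Y. *)
Lemma syz_functor_faithful X Y (f g : bihom X Y) : gproj X ->
  stable_eq (syz_map f) (syz_map g) -> stable_eq f g.
Proof.
move=> gX [Q [u [v [pQ e]]]].
have eX := syz_short_exact X; have eY := syz_short_exact Y.
have [u' u'E] := ext1_projective (gproj_ext1 gX) pQ u.
pose w := comphom (syz_incl Y) (comphom v u').
pose d := addhom (addhom (free_map f) (opphom (free_map g))) (opphom w).
have [z|s sE] := factor_through_epi (f := d) eX.
  have := congr1 (fun h : 'Hom(syz X, syz Y) => h z) e.
  rewrite add_lfunE opp_lfunE comp_lfunE => ez.
  have mapE (h : bihom X Y) : free_map h (syz_incl X z) = syz_incl Y (syz_map h z).
    by rewrite !syz_inclE syz_mapE.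
  rewrite !addhomE !opphomE /w !comphomE u'E -ez !mapE.
  by rewrite [in X in _ - X]linearB /= subrr.
exists (free_on Y), s, (cover Y); split; first exact: free_projective.
apply/lfunP => x; have [z <-] := short_exact_surj eX x.
rewrite [RHS]comp_lfunE sE !addhomE !opphomE /w !comphomE !linearB /=.
by rewrite !cover_nat (short_exact_comp0 eY) subr0 add_lfunE opp_lfunE.
Qed.

Lemma syz_functor_dense Y : gproj Y ->
  exists2 X, gproj X & @isomorphic (stab A k^o) (syz X) Y.
Proof.
move=> /gproj_coresolution [X [P [i [p [e pP gX]]]]]; exists X => //.
have [kappa lk] := lifts_to_exists (idhom X) (syz_short_exact X) e
  (@free_projective _ _ _ X).
exists kappa; apply: (lifts_to_iso (syz_short_exact X) e _ pP lk).
exact: free_projective.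
Qed.

Lemma gdim0_iter_syz n X :
  gdim0 X -> gdim0 (iter_functor n (syz_functor A k^o) X : lmod A).
Proof.
elim: n => [|n IH] //= gX; apply: gproj_gdim0; apply: gproj_syz.
exact/gdim0_gproj/IH.
Qed.

Lemma iter_syz_fully_faithful n :
  @fully_faithful_on (stab A k^o) (stab A k^o) (@gdim0 k A) (@gdim0 k A)
    (iter_functor n (syz_functor A k^o)).
Proof.
have ff1 : @fully_faithful_on (stab A k^o) (stab A k^o) (@gdim0 k A)
    (@gdim0 k A) (syz_functor A k^o).
  split=> [X Y f g gX _|X Y h gX _|Y gY].
  - exact: (syz_functor_faithful (gdim0_gproj gX)).
  - exact: (syz_functor_full h (gdim0_gproj gX)).
  - have [X gX XY] := syz_functor_dense (gdim0_gproj gY).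
    by exists X => //; apply: gproj_gdim0.
elim: n => [|n IH]; first exact: fully_faithful_on_id.
by apply: fully_faithful_on_comp IH ff1; apply: gdim0_iter_syz.
Qed.

End SyzygyEquivalence.

Lemma singular_equivalence_composite (k : fieldType) (A B : falgType k) n
    (M : bimod A B) (N : bimod B A) :
  @isomorphic (stab B B) (tens N M) (iter n (@syz k B B) (reg B)) ->
  stably_natural_iso (tens_tens_map M N)
    (of_functor (iter_functor n (syz_functor B k^o))).
Proof.
move=> [f fI]; apply: stably_natural_iso_trans (tens_assoc_natural M N) _.
apply: stably_natural_iso_trans (tens_stable_natural fI) _.
exact: tens_iter_syz_natural.
Qed.

Theorem proposition4p5 (k : fieldType) (A B : falgType k)
  (gldimA : infinite_gldim A) (gldimB : infinite_gldim B)
  (n : nat) (M : bimod A B) (N : bimod B A)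
  (MN : singular_equivalence n M N)
  (pdM : finite_pd (lres (ldual M))) (pdN : finite_pd (lres (ldual N))) :
  let FM := tens_functor k^o (se_projMl MN) in
  let FN := tens_functor k^o (se_projNl MN) in
  let SA := iter_functor n (syz_functor A k^o) in
  let SB := iter_functor n (syz_functor B k^o) in
  exists (gM : forall X : lmod B, gdim0 X -> gdim0 (tens M X))
         (gN : forall X : lmod A, gdim0 X -> gdim0 (tens N X))
         (gSA : forall X : lmod A, gdim0 X -> gdim0 (SA X : lmod A))
         (gSB : forall X : lmod B, gdim0 X -> gdim0 (SB X : lmod B)),
    let GM : functor (gstab B) (gstab A) := full_functor (F := FM) gM in
    let GN : functor (gstab A) (gstab B) := full_functor (F := FN) gN in
    let OA : functor (gstab A) (gstab A) := full_functor (F := SA) gSA in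
    let OB : functor (gstab B) (gstab B) := full_functor (F := SB) gSB in
    [/\ is_equivalence GM, is_equivalence GN,
        is_equivalence OA, is_equivalence OB
      & quasi_inverse_up_to GM GN OB OA].
Proof.
move=> FM FN SA SB.
have gM (X : lmod B) : gdim0 X -> gdim0 (tens M X).
  move=> /gdim0_gproj gX; apply: gproj_gdim0.
  exact: tens_gproj (se_projMl MN) (se_projMr MN) pdM _ gX.
have gN (X : lmod A) : gdim0 X -> gdim0 (tens N X).
  move=> /gdim0_gproj gX; apply: gproj_gdim0.
  exact: tens_gproj (se_projNl MN) (se_projNr MN) pdN _ gX.
exists gM, gN, (@gdim0_iter_syz k A n), (@gdim0_iter_syz k B n).
move=> GM GN OA OB.
have wA : weak_equivalence OA :=
  weak_equivalence_full _ (iter_syz_fully_faithful A n).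
have wB : weak_equivalence OB :=
  weak_equivalence_full _ (iter_syz_fully_faithful B n).
have nB : nat_iso (comp_functor GN GM) OB.
  have [eta [etaI etaN]] := singular_equivalence_composite (se_NM MN).
  exists (fun X => eta (sval X)); split=> [X|X Y f].
    exact: (etaI (sval X)).
  exact: (etaN (sval X) (sval Y) f).
have nA : nat_iso (comp_functor GM GN) OA.
  have [eta [etaI etaN]] := singular_equivalence_composite (se_MN MN).
  exists (fun X => eta (sval X)); split=> [X|X Y f].
    exact: (etaI (sval X)).
  exact: (etaN (sval X) (sval Y) f).
have wNM := weak_equivalence_nat_iso nB wB.
have wMN := weak_equivalence_nat_iso nA wA.
split; last by split.
- exact/weak_equivalence_is_equivalence/(weak_equivalence_two_sided wNM wMN).
- exact/weak_equivalence_is_equivalence/(weak_equivalence_two_sided wMN wNM).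
- exact: weak_equivalence_is_equivalence.
- exact: weak_equivalence_is_equivalence.
Qed.
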